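(* Let $K$ be a convex polygon in the plane, given by the Cartesian coordinates of its vertices, with sides $S_1,\dots,S_n$ (no two sides collinear). The density of measure $\rho_K(\ell)$ of the length of the chords of $K$ is the sum over all pairs of sides $$\rho_K(\ell)=\sum_{1\le i<j\le n}\rho_{ij}(\ell),$$ where $\rho_{ij}$ is computed from the coordinates of the endpoints of $S_i=AA'$ and $S_j=BB'$ as follows. (1) If $S_i$ and $S_j$ are not parallel, let $O=(x_O,y_O)$ be $$x_O=\frac{(x_{A'}-x_A)D_B-(x_{B'}-x_B)D_A}{N},\quad y_O=\frac{(y_{A'}-y_A)D_B-(y_{B'}-y_B)D_A}{N},$$ with $D_A=x_Ay_{A'}-y_Ax_{A'}$, $D_B=x_By_{B'}-y_Bx_{B'}$, $N=(x_{A'}-x_A)(y_{B'}-y_B)-(y_{A'}-y_A)(x_{B'}-x_B)$ (the intersection of the supporting lines). Label the endpoints so that $|OA|<|OA'|$ and $|OB|<|OB'|$, and let $\gamma=\arccos\frac{\overrightarrow{AA'}\cdot\overrightarrow{BB'}}{|\overrightarrow{AA'}||\overrightarrow{BB'}|}$. Then $$\rho_{ij}(\ell)=\rho(|OA'|,|OB'|,\gamma;\ell)-\rho(|OA|,|OB'|,\gamma;\ell)-\rho(|OA'|,|OB|,\gamma;\ell)+\rho(|OA|,|OB|,\gamma;\ell).$$ (2) If $S_i$ and $S_j$ are parallel, let $d$ be the distance between their supporting lines and let $x_P$ be the coordinate of a point $P$ along their common direction, the endpoints being labelled so that $x_A<x_{A'}$, $x_B<x_{B'}$. Then $\rho_{ij}(\ell)=0$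 for $\ell<d$, and for $\ell>d$, with $r=\sqrt{\ell^2-d^2}$, $$\rho_{ij}(\ell)=\frac{d^2}{\ell^2 r}\Big[h\big(\min(x_{B'}-r,x_{A'})-\max(x_B-r,x_A)\big)+h\big(\min(x_{B'}+r,x_{A'})-\max(x_B+r,x_A)\big)\Big],$$ where $h(x)=\max(x,0)$.
   Context: $\mu$ is the translation- and rotation-invariant measure on straight lines of the plane, normalized as $d\mu=dp\,d\theta$ ($\theta\in[0,\pi)$ the direction of the line, $p$ its signed distance to the origin). A chord of $K$ is the intersection of $K$ with a line meeting it; sets of chords carry the measure $\mu$ of the corresponding lines. The density of measure of the length of the chords is the function $\rho_K$ such that the $\mu$-measure of the chords with length in a Borel set $E\subset(0,\infty)$ is $\int_E\rho_K(\ell)\,d\ell$ (determined up to null sets). The function $\rho(a,b,\gamma;\ell)$: it is $0$ if $a=0$ or $b=0$. For $a,b>0$, $0<\gamma<\pi$, put $c=\sqrt{a^2+b^2-2ab\cos\gamma}$, $\alpha=\arccos\frac{b-a\cos\gamma}{c}$, $\beta=\arccos\frac{a-b\cos\gamma}{c}$ (the angles opposite to $a$, $b$ in the triangle with sides $a,b,c$), and $\Delta=\frac12ab\sin\gamma$. Then $\rho(a,b,\gamma;\ell)=\rho_{aB}(\ell,\alpha,\beta,\gamma,a,b,c)+\rho_{aB}(\ell,\beta,\alpha,\gamma,b,a,c)$, where, with $t=\frac{2\Delta}{b\ell}$, $f=\arcsin t-t\sqrt{1-t^2}$ and $H$ the Heaviside function (terms with a vanishing Heaviside factor being $0$), $\rho_{aB}(\ell,\alpha,\beta,\gamma,a,b,c)$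 equals $\frac{ab}{4\Delta}$ times: (i) if $\alpha,\gamma\le\pi/2$: $H(\frac{2\Delta}{b}-\ell)(\beta\cos\gamma+\cos\alpha\sin\beta)+H(c-\ell)H(\ell-\frac{2\Delta}{b})\big((f-\alpha)\cos\gamma+t^2\sin\gamma-\sin\alpha\cos\beta\big)+H(a-\ell)H(\ell-\frac{2\Delta}{b})\big((f-\gamma)\cos\gamma+(1-t^2)\sin\gamma\big)$; (ii) if $\alpha>\pi/2$: $H(c-\ell)(\beta\cos\gamma+\cos\alpha\sin\beta)+H(\ell-c)H(a-\ell)\big((f-\gamma)\cos\gamma+(1-t^2)\sin\gamma\big)$; (iii) if $\gamma>\pi/2$: $H(a-\ell)(\beta\cos\gamma+\cos\alpha\sin\beta)+H(\ell-a)H(c-\ell)\big((f+\sin\alpha\cos\alpha-\alpha)\cos\gamma+(t^2-\sin^2\alpha)\sin\gamma\big)$. *)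

(* Defs.v *)
From HB Require Import structures.
From mathcomp Require Import all_boot all_order all_algebra.
From mathcomp Require Import all_classical all_reals all_analysis.

Set Implicit Arguments.
Unset Strict Implicit.
Unset Printing Implicit Defensive.

Import Order.TTheory GRing.Theory Num.Theory.
Import numFieldNormedType.Exports.

Local Open Scope classical_set_scope.
Local Open Scope ring_scope.

Section Plane.
Variable R : realType.

Definition plane : Type := (R * R)%type.

Implicit Types (P Q : plane).

Definition vec P Q : plane := (Q.1 - P.1, Q.2 - P.2).
Definition dot P Q : R := P.1 * Q.1 + P.2 * Q.2.
Definition det2 P Q : R := P.1 * Q.2 - P.2 * Q.1.

(* Euclidean norm: the library norm on [R * R] is the sup norm. *)
Definition enorm P : R := Num.sqrt (dot P P).
Definition edist P Q : R := enorm (vec P Q).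

End Plane.

Section Polygon.
Variables (R : realType) (n : nat).
Implicit Types (v : 'I_n -> plane R) (i j k : 'I_n).

(* [side v i] is the pair of endpoints of the i-th side; [ordS] is the cyclic
   successor, so that the last side joins the last vertex to the first one. *)
Definition side v i : plane R * plane R := (v i, v (ordS i)).

(* Zero iff [P] lies on the supporting line of the i-th side; its sign tells
   on which side of that line [P] lies. *)
Definition side_of v i (P : plane R) : R :=
  det2 (vec (side v i).1 (side v i).2) (vec (side v i).1 P).

(* Both orientations of the boundary are allowed. *)
Definition convex_polygon v : Prop :=
  [/\ (2 < n)%N, injective v &
      forall i, (forall k, 0 <= side_of v i (v k)) \/
                (forall k, side_of v i (v k) <= 0)].

Definition collinear_sides v i j : Prop :=
  side_of v i (side v j).1 = 0 /\ side_of v i (side v j).2 = 0.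

Definition no_collinear_sides v : Prop :=
  forall i j, i != j -> ~ collinear_sides v i j.

(* The plane region bounded by the polygon: the convex hull of its vertices. *)
Definition region v : set (R * R) :=
  [set P | exists w : 'I_n -> R,
     [/\ forall i, 0 <= w i, \sum_i w i = 1,
         P.1 = \sum_i w i * (v i).1 & P.2 = \sum_i w i * (v i).2]].

End Polygon.

Section Chords.
Variable R : realType.
Implicit Types (K : set (R * R)) (q : R * R) (E : set (measurableTypeR R)).

(* A pair [q = (p, theta)] with [theta] in [0, pi[ represents the line with
   direction (cos theta, sin theta) at signed distance p from the origin; every
   line has exactly one such representation. *)
Definition lines : set (R * R) := [set q | q.2 \in `[0, pi[].

Definition line_pt q (t : R) : R * R :=
  (t * cos q.2 - q.1 * sin q.2, t * sin q.2 + q.1 * cos q.2).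

Definition chord K q : set (R * R) := K `&` range (line_pt q).

(* [line_pt q] is a unit-speed parametrization of the line. *)
Definition chord_length K q : \bar R :=
  lebesgue_measure (line_pt q @^-1` chord K q).

(* d mu = dp d theta; meant for subsets of [lines]. *)
Definition line_measure : set (R * R) -> \bar R :=
  (@lebesgue_measure R \x @lebesgue_measure R)%E.

Definition chords_with_length_in K E : set (R * R) :=
  [set q | [/\ lines q, chord K q !=set0 &
               (EFin @` E) (chord_length K q)]].

(* The measurability clauses are what gives a meaning to "the measure of the
   chords with length in E" and to the integral of [rho]: the library's
   [lebesgue_measure \x lebesgue_measure] and integral are total functions. *)
Definition is_chord_length_density K (rho : R -> R) : Prop :=
  @measurable_fun _ _ (measurableTypeR R) (measurableTypeR R) `]0, +oo[ rho /\
  forall E, measurable E -> E `<=` `]0, +oo[ ->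
    @measurable _ (measurableTypeR R * measurableTypeR R)%type
      (chords_with_length_in K E) /\
    line_measure (chords_with_length_in K E) =
      (\int[@lebesgue_measure R]_(l in E) (rho l)%:E)%E.

End Chords.

Section Density.
Variable R : realType.

(* The value at 0 only affects densities on a finite set. *)
Definition heaviside (x : R) : R := if 0 <= x then 1 else 0.

(* When a Heaviside factor vanishes its term is 0, whatever the values of
   [asin] and [Num.sqrt] outside their natural domains. *)
Definition rho_aB (l alpha beta gamma a b c : R) : R :=
  let H := heaviside in
  let Delta := 2^-1 * a * b * sin gamma in
  let t := 2 * Delta / (b * l) in
  let f := asin t - t * Num.sqrt (1 - t ^+ 2) in
  a * b / (4 * Delta) *
  (if pi / 2 < alpha then
     H (c - l) * (beta * cos gamma + cos alpha * sin beta)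
     + H (l - c) * H (a - l)
       * ((f - gamma) * cos gamma + (1 - t ^+ 2) * sin gamma)
   else if pi / 2 < gamma then
     H (a - l) * (beta * cos gamma + cos alpha * sin beta)
     + H (l - a) * H (c - l)
       * ((f + sin alpha * cos alpha - alpha) * cos gamma
          + (t ^+ 2 - sin alpha ^+ 2) * sin gamma)
   else
     H (2 * Delta / b - l) * (beta * cos gamma + cos alpha * sin beta)
     + H (c - l) * H (l - 2 * Delta / b)
       * ((f - alpha) * cos gamma + t ^+ 2 * sin gamma - sin alpha * cos beta)
     + H (a - l) * H (l - 2 * Delta / b)
       * ((f - gamma) * cos gamma + (1 - t ^+ 2) * sin gamma)).

Definition rho (a b gamma l : R) : R :=
  if (a == 0) || (b == 0) then 0 else
  let c := Num.sqrt (a ^+ 2 + b ^+ 2 - 2 * a * b * cos gamma) in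
  let alpha := acos ((b - a * cos gamma) / c) in
  let beta := acos ((a - b * cos gamma) / c) in
  rho_aB l alpha beta gamma a b c + rho_aB l beta alpha gamma b a c.

Implicit Types (S T : plane R * plane R) (P O : plane R).

(* Zero iff the segments [S] and [T] are parallel. *)
Definition sides_N S T : R := det2 (vec S.1 S.2) (vec T.1 T.2).

(* The intersection of the supporting lines of [S] and [T], if not parallel. *)
Definition sides_O S T : plane R :=
  let: (A, A') := S in
  let: (B, B') := T in
  let DA := det2 A A' in
  let DB := det2 B B' in
  (((A'.1 - A.1) * DB - (B'.1 - B.1) * DA) / sides_N S T,
   ((A'.2 - A.2) * DB - (B'.2 - B.2) * DA) / sides_N S T).

Definition label_from O S : plane R * plane R :=
  if edist O S.1 < edist O S.2 then S else (S.2, S.1).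

Definition rho_nonparallel S T (l : R) : R :=
  let O := sides_O S T in
  let: (A, A') := label_from O S in
  let: (B, B') := label_from O T in
  let gamma :=
    acos (dot (vec A A') (vec B B') / (enorm (vec A A') * enorm (vec B B'))) in
  rho (edist O A') (edist O B') gamma l - rho (edist O A) (edist O B') gamma l
  - rho (edist O A') (edist O B) gamma l + rho (edist O A) (edist O B) gamma l.

Definition pospart (x : R) : R := Num.max x 0.

(* [xS P] is the coordinate of [P] along the common direction, oriented by [S];
   the formula is invariant under reversal of this orientation.  The
   value at the single point [l = d] is immaterial. *)
Definition rho_parallel S T (l : R) : R :=
  let e := enorm (vec S.1 S.2) in
  let d := `|det2 (vec S.1 S.2) (vec S.1 T.1)| / e in
  let xS P := dot P (vec S.1 S.2) / e in
  let xA := Num.min (xS S.1) (xS S.2) in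
  let xA' := Num.max (xS S.1) (xS S.2) in
  let xB := Num.min (xS T.1) (xS T.2) in
  let xB' := Num.max (xS T.1) (xS T.2) in
  let r := Num.sqrt (l ^+ 2 - d ^+ 2) in
  let h := pospart in
  if l <= d then 0 else
  d ^+ 2 / (l ^+ 2 * r) *
  (h (Num.min (xB' - r) xA' - Num.max (xB - r) xA)
   + h (Num.min (xB' + r) xA' - Num.max (xB + r) xA)).

Definition rho_pair S T (l : R) : R :=
  if sides_N S T == 0 then rho_parallel S T l else rho_nonparallel S T l.

End Density.

(* Main.v *)
From HB Require Import structures.
From mathcomp Require Import all_boot all_order all_algebra.
From mathcomp Require Import all_classical all_reals all_analysis.
From mathcomp Require Import measurable_realfun ring lra.
Require Import Defs.

(** A chord of [K] that avoids the vertices joins two sides of [K], and these are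
    the only sides that its line meets.  So, up to null sets, the chords whose
    length lies in [E] are the disjoint union, over the pairs of sides, of the
    lines that meet both sides and cut off between them a length in [E]
    ([chords_cut_lines], [cut_lines_disjoint], [measure_ysection_chords]), and
    everything reduces to one pair of segments.

    For such a pair the direction [th] of the line is fixed first.  If the
    supporting lines meet at [O], the length cut off by the line at distance [p]
    is proportional to its distance to [O]: with [u] and [pi - g - u] the angles
    that the line makes with two rays from [O] at angle [g],
    [dp = sin u * sin (u + g) / sin g * dl] ([cut_lines_rays_measure]).  By
    Tonelli's theorem the density at [l] is therefore the integral of
    [sin u * sin (u + g) / sin g] over the directions in which a chord of length
    [l] fits between the two segments.  The law of sines turns this condition
    into bounds on [sin u] and [sin (u + g)], inclusion-exclusion reduces it to
    segments issued from [O] ([integral_box]), and splitting the range at the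
    direction of the third side of the triangle leaves integrals of
    [sin u * sin (u + g)] over sublevel sets of the sine
    ([integral_sector], [integral_sinsin_rho_aB]); the case distinctions and the
    Heaviside factors of [rho_aB] describe these sets.

    If the segments are parallel at distance [d], all lines of direction [th] cut
    off the same length [d / |sin u|], with [u] the angle of the line with the
    segments, and the lines meeting both segments have measure [|sin u|] times
    the overlap of one segment with the other slid by [d / tan u]
    ([cut_lines_strip]).  The formula follows from the change of variable
    [l = d / sin u], separately on the two halves of [[0, pi[]
    ([cosecant_substitution]); as its Jacobian is singular at [l = d], it is
    carried out away from [d] and extended to Borel sets by uniqueness of
    measures.

    Finally the length of the chord is a measurable function of the line because
    the region is the intersection of the half-planes bounded by its sides
    ([region_half_planesE]), hence a Borel set. *)

Set Implicit Arguments.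
Unset Strict Implicit.
Unset Printing Implicit Defensive.

Import Order.TTheory GRing.Theory Num.Theory.
Import numFieldNormedType.Exports.

Local Open Scope classical_set_scope.
Local Open Scope ring_scope.

(** * Lebesgue measure and integral on the line *)

Section LebesgueTools.
Variable R : realType.
Notation mu := (@lebesgue_measure R).
Notation mR := (measurableTypeR R).

Lemma finite_measurableR (N : set R) : finite_set N -> measurable (N : set mR).
Proof.
move=> fN; apply: countable_measurable; first exact: measurable_set1.
exact: finite_set_countable.
Qed.

Lemma finite_lebesgue_measure0 (N : set R) : finite_set N -> mu N = 0%E.
Proof.
move=> fN; apply: countable_lebesgue_measure0; exact: finite_set_countable.
Qed.

Lemma lebesgue_measureD_finite (A N : set mR) : measurable A -> finite_set N ->
  mu (A `\` N) = mu A.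
Proof.
move=> mA fN.
have mN := finite_measurableR fN.
have -> : mu A = (mu (A `\` N) + mu (A `&` N))%E.
  rewrite -measureU//; [by rewrite setUC setUIDK| | |].
  - exact: measurableD.
  - exact: measurableI.
  - by apply/seteqP; split => // x [[_ nx] [_ /nx]].
rewrite [X in (_ + X)%E](_ : _ = 0%E) ?adde0//.
apply/finite_lebesgue_measure0; exact: finite_setIr.
Qed.

Lemma lebesgue_measure_eq_off_finite (A B N : set mR) :
  measurable A -> measurable B -> finite_set N -> A `\` N = B `\` N ->
  mu A = mu B.
Proof.
by move=> mA mB fN AB; rewrite -(lebesgue_measureD_finite mA fN) AB
  lebesgue_measureD_finite.
Qed.

Lemma measurable_eq_off_finite (D N : set mR) (f g : mR -> mR) :
  measurable D -> finite_set N -> (forall x, D x -> ~ N x -> f x = g x) ->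
  measurable_fun D f -> measurable_fun D g.
Proof.
move=> mD fN fg mf.
have mN := finite_measurableR fN.
have -> : D = (D `\` N) `|` (D `&` N) by rewrite setUC setUIDK.
apply/measurable_funU; [exact: measurableD|exact: measurableI|split].
  apply: (@eq_measurable_fun _ _ _ _ _ f).
    by move=> x; rewrite inE => -[Dx Nx]; exact: fg.
  by apply: measurable_funS mf => //; exact: subDsetl.
move=> _ B mB; apply: finite_measurableR.
by apply: finite_setIl; exact: finite_setIr.
Qed.

Lemma integral_eq_off_finite (D N : set mR) (f g : mR -> \bar R) :
  measurable D -> finite_set N -> measurable_fun D f -> measurable_fun D g ->
  (forall x, D x -> ~ N x -> f x = g x) ->
  (\int[mu]_(x in D) f x = \int[mu]_(x in D) g x)%E.
Proof.
move=> mD fN mf mg fg; apply: ae_eq_integral => //.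
exists N; split; [exact: finite_measurableR|exact: finite_lebesgue_measure0|].
by move=> x /=; apply: contra_notP => Nx Dx; exact: fg.
Qed.

Lemma measurable_invr : measurable_fun [set: mR] (fun x : mR => x^-1 : mR).
Proof.
have -> : [set: mR] = ~` [set 0] `|` [set 0] by rewrite setUC setUv.
apply/measurable_funU; [exact: measurableC|exact: measurable_set1|split].
  apply: open_continuous_measurable_fun.
    by apply: closed_openC; exact: closed_eq.
  by move=> x; rewrite inE => /eqP x0; exact: inv_continuous.
exact: measurable_fun_set1.
Qed.

(** Affine maps are the only changes of variable that the lines of a fixed
    direction require. *)
Lemma lebesgue_measure_affine (c d : R) (E : set mR) : c != 0 -> measurable E ->
  mu ((fun x => c * x + d) @^-1` E) = (`|c|^-1%:E * mu E)%E.
Proof.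
move=> c0 mE.
have mf : measurable_fun [set: mR] (fun x : mR => c * x + d : mR).
  by apply: measurable_funD => //; apply: measurable_funM.
pose f : {mfun mR >-> mR} := HB.pack (fun x : mR => c * x + d : mR)
  (isMeasurableFun.Build _ _ _ _ _ mf).
have c0' : 0 < `|c| by rewrite normr_gt0.
pose k : {nonneg R} := NngNum (ltW c0').
pose m0 : {measure set mR -> \bar R} := pushforward mu f.
pose m : {measure set mR -> \bar R} := mscale k (m0 mf).
suff -> : mu E = m E.
  by rewrite /m /m0 /mscale/= muleA -EFinM mulVf ?mul1e ?gt_eqF.
apply: (@lebesgue_measure_unique R m) => // X [[a b]] _ <-.
have fE : f @^-1` `]a, b] =
  if 0 < c then `](a - d) / c, (b - d) / c]%classic
  else `[(b - d) / c, (a - d) / c[%classic.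
case: ltP => [cp|]; last rewrite le_eqVlt (negbTE c0) /= => cn.
    apply/seteqP; split => x /=; rewrite !in_itv/= ltr_pdivrMr// ler_pdivlMr//;
      by rewrite [x * c]mulrC => /andP[? ?]; apply/andP; split; lra.
  apply/seteqP; split => x /=; rewrite !in_itv/= ltr_ndivlMr// ler_ndivrMr//;
      by rewrite [x * c]mulrC => /andP[? ?]; apply/andP; split; lra.
rewrite [m _](_ : _ = `|c|%:E * mu (f @^-1` `]a, b]))%E// fE.
case: ltP => [cp|]; last rewrite le_eqVlt (negbTE c0) /= => cn.
  rewrite !lebesgue_measure_itv/= !lte_fin ltr_pM2r ?invr_gt0// ltrD2r.
  case: ifPn => _; last by rewrite mule0.
  rewrite -!EFinB -EFinM gtr0_norm//; congr EFin; field.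
  by rewrite gt_eqF.
rewrite !lebesgue_measure_itv/= !lte_fin ltr_nM2r ?invr_lt0// ltrD2r.
case: ifPn => _; last by rewrite mule0.
rewrite -!EFinB -EFinM ltr0_norm//; congr EFin; field.
by rewrite lt_eqF.
Qed.

Lemma ge0_integral_translation (d : R) (D : set mR) (f : mR -> \bar R) :
  measurable D -> measurable_fun D f -> (forall x, D x -> 0 <= f x)%E ->
  (\int[mu]_(x in (fun x => (x + d)%R) @^-1` D) f (x + d)%R =
   \int[mu]_(x in D) f x)%E.
Proof.
move=> mD mf f0.
have mg : measurable_fun [set: mR] (fun x : mR => x + d : mR).
  exact: measurable_funD.
pose g : {mfun mR >-> mR} := HB.pack (fun x : mR => x + d : mR)
  (isMeasurableFun.Build _ _ _ _ _ mg).
have /= <- := @ge0_integral_pushforward _ _ _ _ _ g mg mu D f mD mf.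
  apply: eq_measure_integral => A mA _.
  have := @lebesgue_measure_affine 1 d A (oner_neq0 _) mA.
  rewrite normr1 invr1 mul1e.
  by rewrite (_ : (fun x => 1 * x + d) = g) //; apply/funext => x; rewrite mul1r.
by move=> x; rewrite inE; exact: f0.
Qed.

Lemma ge0_integral_reflection (d : R) (D : set mR) (f : mR -> \bar R) :
  measurable D -> measurable_fun D f -> (forall x, D x -> 0 <= f x)%E ->
  (\int[mu]_(x in (fun x => (d - x)%R) @^-1` D) f (d - x)%R =
   \int[mu]_(x in D) f x)%E.
Proof.
move=> mD mf f0.
have mg : measurable_fun [set: mR] (fun x : mR => d - x : mR).
  exact: measurable_funB.
pose g : {mfun mR >-> mR} := HB.pack (fun x : mR => d - x : mR)
  (isMeasurableFun.Build _ _ _ _ _ mg).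
have /= <- := @ge0_integral_pushforward _ _ _ _ _ g mg mu D f mD mf.
  apply: eq_measure_integral => A mA _.
  have N1 : (- 1 : R) != 0 by rewrite oppr_eq0 oner_neq0.
  have := @lebesgue_measure_affine (-1) d A N1 mA.
  rewrite normrN1 invr1 mul1e.
  rewrite (_ : (fun x => -1 * x + d) = g) //; apply/funext => x.
  by rewrite mulN1r addrC.
by move=> x; rewrite inE; exact: f0.
Qed.

(** The measure on lines does not depend on the direction from which angles are
    counted. *)
Lemma ge0_integral_periodic (T phi : R) (f : mR -> \bar R) :
  0 <= phi <= T -> measurable_fun setT f -> (forall x, 0 <= f x)%E ->
  (forall x, f (x + T) = f x) ->
  (\int[mu]_(x in `[0%R, T[) f (x - phi)%R = \int[mu]_(x in `[0%R, T[) f x)%E.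
Proof.
move=> /andP[p0 pT] mf f0 fT.
have mf' D : measurable_fun D f by exact: measurable_funTS.
have -> : `[0, T[%classic = (fun x => x - phi) @^-1` `[- phi, T - phi[ :> set mR.
  by apply/seteqP; split => x /=; rewrite !in_itv/= => /andP[? ?];
    apply/andP; split; lra.
rewrite ge0_integral_translation//.
have -> : (fun x => x - phi) @^-1` `[- phi, T - phi[ = `[0, T[%classic :> set mR.
  by apply/seteqP; split => x /=; rewrite !in_itv/= => /andP[? ?];
    apply/andP; split; lra.
have split_co a b c : a <= b -> b <= c ->
    (\int[mu]_(x in `[a, c[) f x =
     \int[mu]_(x in `[a, b[) f x + \int[mu]_(x in `[b, c[) f x)%E.
  move=> ab bc; rewrite -ge0_integral_setU//; last first.
    by apply/disj_setPS => x [] /=; rewrite !in_itv/= => /andP[_ ?] /andP[? _]; lra.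
  congr (integral _ _ _); apply/seteqP; split => x /=; rewrite !in_itv/=.
    move=> /andP[-> ->]; rewrite andbT/=; case: (ltP x b) => _; by [left|right].
  by move=> [|] /andP[? ?]; apply/andP; split; lra.
rewrite (split_co (- phi) 0) ?(split_co 0 (T - phi) T); [|lra..].
rewrite addeC; congr (_ + _)%E.
rewrite -[RHS](@ge0_integral_translation T)//.
rewrite (_ : _ @^-1` _ = `[- phi, 0[%classic).
  by apply: eq_integral => x _; rewrite fT.
by apply/seteqP; split => x /=; rewrite !in_itv/= => /andP[? ?];
  apply/andP; split; lra.
Qed.

Lemma ge0_tonelli_sets (D E : set R) (w : R -> R -> R) :
  measurable D -> measurable E ->
  measurable_fun [set: R * R] (fun z : R * R => w z.1 z.2) ->
  (forall x y, 0 <= w x y) ->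
  measurable_fun [set: R] (fun x => \int[mu]_(y in E) (w x y)%:E)%E /\
  measurable_fun [set: R] (fun y => \int[mu]_(x in D) (w x y)%:E)%E /\
  (\int[mu]_(x in D) \int[mu]_(y in E) (w x y)%:E =
   \int[mu]_(y in E) \int[mu]_(x in D) (w x y)%:E)%E.
Proof.
move=> mD mE mw w0.
have mf A B : measurable A -> measurable B -> measurable_fun [set: R * R]
    ((fun z : R * R => (w z.1 z.2)%:E) \_ (A `*` B)).
  move=> mA mB; apply/(measurable_restrictT _ _).1; first exact: measurableX.
  by apply/measurable_EFinP; exact: measurable_funTS.
have f0 A B (z : R * R) : (0 <= ((fun z => (w z.1 z.2)%:E) \_ (A `*` B)) z)%E.
  by apply: erestrict_ge0 => *; rewrite lee_fin.
have sec1 A B x : (\int[mu]_y (((fun z : R * R => (w z.1 z.2)%:E) \_ (A `*` B)) (x, y)) =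
    ((fun x => \int[mu]_(y in B) (w x y)%:E) \_ A) x)%E.
  rewrite patchE; case: ifPn => [xA|xA].
    rewrite [RHS]integral_mkcond; apply: eq_integral => y _.
    by rewrite !patchE /= in_setX xA.
  by apply: integral0_eq => y _; rewrite patchE in_setX (negbTE xA).
have sec2 A B y : (\int[mu]_x (((fun z : R * R => (w z.1 z.2)%:E) \_ (A `*` B)) (x, y)) =
    ((fun y => \int[mu]_(x in A) (w x y)%:E) \_ B) y)%E.
  rewrite patchE; case: ifPn => [xA|xA].
    rewrite [RHS]integral_mkcond; apply: eq_integral => x _.
    by rewrite !patchE /= in_setX xA andbT.
  by apply: integral0_eq => x _; rewrite patchE in_setX (negbTE xA) andbF.
split; [|split].
- have := measurable_fun_fubini_tonelli_F (m2 := mu) _ (mf _ _ measurableT mE) (f0 _ _).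
  by rewrite /fubini_F; under eq_fun do rewrite sec1 patch_setT.
- have := measurable_fun_fubini_tonelli_G (m1 := mu) _ (mf _ _ mD measurableT) (f0 _ _).
  by rewrite /fubini_G; under eq_fun do rewrite sec2 patch_setT.
- rewrite integral_mkcond [RHS]integral_mkcond.
  pose f := (fun z : R * R => (w z.1 z.2)%:E) \_ (D `*` E).
  transitivity (\int[mu]_x \int[mu]_y f (x, y))%E.
    by apply: eq_integral => x _; rewrite /f sec1.
  rewrite (fubini_tonelli (m1 := mu) (m2 := mu) f (mf _ _ mD mE) (f0 _ _)).
  by apply: eq_integral => y _; rewrite /f sec2.
Qed.

Lemma measurable_setb d (X : measurableType d) (q : X -> bool) :
  measurable_fun [set: X] q -> measurable [set x | q x].
Proof.
move=> mq; rewrite [X in measurable X](_ : _ = [set: X] `&` q @^-1` [set true]).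
  exact: mq.
by apply/seteqP; split => x /=; [move=> ->|case].
Qed.

Lemma cvg_maxr (X : topologicalType) (F : set_system X) (f g : X -> R) (x y : R) :
  Filter F -> f z @[z --> F] --> x -> g z @[z --> F] --> y ->
  Num.max (f z) (g z) @[z --> F] --> Num.max x y.
Proof.
move=> FF fx gy; rewrite maxr_absE.
under eq_cvg do rewrite maxr_absE.
apply: cvgM; last exact: cvg_cst.
apply: cvgD; first exact: cvgD.
by apply: cvg_norm; exact: cvgB.
Qed.

Lemma cvg_minr (X : topologicalType) (F : set_system X) (f g : X -> R) (x y : R) :
  Filter F -> f z @[z --> F] --> x -> g z @[z --> F] --> y ->
  Num.min (f z) (g z) @[z --> F] --> Num.min x y.
Proof.
move=> FF fx gy; rewrite minr_absE.
under eq_cvg do rewrite minr_absE.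
apply: cvgM; last exact: cvg_cst.
apply: cvgB; first exact: cvgD.
by apply: cvg_norm; exact: cvgB.
Qed.

End LebesgueTools.

(** * Integrals over the directions of the chords of an angle *)

Section TrigIntegral.
Variable R : realType.
Notation mu := (@lebesgue_measure R).
Implicit Types (a b c g l t u x y : R).

(** Density, with respect to [dl du], of the lines cutting off a chord of length
    [l] between the two rays of an angle [g], up to the factor [1 / sin g];
    [u] and [pi - g - u] are the angles of the chord with the rays. *)
Definition sinsin g u : R := sin u * sin (u + g).

Definition sinsin_prim g u : R := (u * cos g - sin u * cos (u + g)) / 2.

Lemma measurable_sin : measurable_fun [set: R] (@sin R).
Proof. by apply: continuous_measurable_fun; exact: continuous_sin. Qed.

Lemma measurable_cos : measurable_fun [set: R] (@cos R).
Proof. by apply: continuous_measurable_fun; exact: continuous_cos. Qed.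

Lemma measurable_sinsin g : measurable_fun [set: R] (sinsin g).
Proof.
apply: measurable_funM; first exact: measurable_sin.
by apply: (measurableT_comp measurable_sin); exact: measurable_funD.
Qed.

Lemma measurable_sinsinE g (D : set R) : measurable_fun D (EFin \o sinsin g).
Proof. apply/measurable_EFinP; exact: measurable_funTS (measurable_sinsin g). Qed.

Lemma sinsin_ge0 g u : 0 < g < pi -> 0 <= u <= pi - g -> 0 <= sinsin g u.
Proof.
move=> /andP[g0 gpi] /andP[u0 ug].
by apply: mulr_ge0; apply: sin_ge0_pi; apply/andP; split; lra.
Qed.

Lemma is_derive_sinsin_prim g u :
  is_derive u 1 (sinsin_prim g) (sinsin g u).
Proof.
have -> : sinsin_prim g = (fun u => 2^-1 *: (cos g *: u - sin u * cos (u + g))).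
  by apply/funext => x; rewrite /sinsin_prim /GRing.scale/= mulrC [x * _]mulrC.
apply: is_derive_eq => /=.
have -> : cos g = cos (u + g - u) by congr cos; ring.
rewrite cosB /sinsin /GRing.scale/=.
lra.
Qed.

Lemma integral_sinsin g x y : x <= y ->
  (\int[mu]_(u in `[x, y]) (sinsin g u)%:E =
   (sinsin_prim g y - sinsin_prim g x)%:E)%E.
Proof.
rewrite le_eqVlt => /predU1P[<-|xy]; first by rewrite set_itv1 integral_set1 subrr.
have dP z : derivable (sinsin_prim g) z 1 by have [] := is_derive_sinsin_prim g z.
have cP : continuous (sinsin_prim g).
  by move=> z; apply: differentiable_continuous; exact/derivable1_diffP.
rewrite (@continuous_FTC2 _ _ (sinsin_prim g))//.
- apply: continuous_subspaceT => z; apply: cvgM; first exact: continuous_sin.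
  apply: (@continuous_comp _ _ _ (fun u => u + g) sin); last exact: continuous_sin.
  by apply: cvgD => //; exact: cvg_cst.
- split => //.
  + by apply: cvg_at_right_filter; exact: cP.
  + by apply: cvg_at_left_filter; exact: cP.
- by move=> z _; rewrite derive1E; have [_ ->] := is_derive_sinsin_prim g z.
Qed.

Lemma sin_le_asin_pihalf t u : 0 <= t <= 1 -> 0 <= u <= pi / 2 ->
  (sin u <= t) = (u <= asin t).
Proof.
move=> /andP[t0 t1] /andP[u0 u2].
have tI : -1 <= t <= 1 by apply/andP; split; lra.
rewrite leNgt -{1}(@asinK _ t) ?in_itv//= ltr_sin ?in_itv/= -?leNgt//.
  by rewrite asin_geNpi2// asin_lepi2.
by apply/andP; split; have := pi_gt0 R; lra.
Qed.

Lemma sin_lt_asin_pihalf t u : 0 <= t <= 1 -> 0 <= u <= pi / 2 ->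
  (sin u < t) = (u < asin t).
Proof.
move=> /andP[t0 t1] /andP[u0 u2].
have tI : -1 <= t <= 1 by apply/andP; split; lra.
rewrite -{1}(@asinK _ t) ?in_itv//= ltr_sin ?in_itv//=.
  by apply/andP; split; have := pi_gt0 R; lra.
by rewrite asin_geNpi2// asin_lepi2.
Qed.

Lemma sin_pisub u : sin (pi - u) = sin u :> R.
Proof. by rewrite sinB sinpi cospi; ring. Qed.

Lemma cos_pisub u : cos (pi - u) = - cos u :> R.
Proof. by rewrite cosB sinpi cospi; ring. Qed.

Lemma sin_le_asin_pi t u : 0 <= t <= 1 -> pi / 2 <= u <= pi ->
  (sin u <= t) = (pi - asin t <= u).
Proof.
move=> t01 /andP[u0 u2]; rewrite -sin_pisub sin_le_asin_pihalf//.
  by rewrite lerBlDr addrC -lerBlDr; congr (_ <= _); ring.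
by apply/andP; split; have := pi_gt0 R; lra.
Qed.

(** The three shapes of a sublevel set of the sine on [[al, pi - g]] are the three
    cases in the definition of [rho_aB]. *)
Lemma sublevel_sin_obtuse_l (al : R) g t : 0 < g -> pi / 2 < al -> al <= pi - g ->
  0 <= t -> t < sin al ->
  [set u | al <= u <= pi - g /\ sin u <= t] = `[pi - asin t, pi - g]%classic.
Proof.
move=> g0 al2 alg t0 tal; have tI : 0 <= t <= 1 by rewrite t0 /=; have := sin_le1 al; lra.
apply/seteqP; split => u /=; rewrite in_itv/=.
  move=> [/andP[u0 u1]]; rewrite sin_le_asin_pi ?u1 ?andbT//.
  by apply/andP; split; lra.
move=> /andP[u0 u1]; have T2 : asin t <= pi / 2 by apply: asin_lepi2; lra.
have u2 : pi / 2 <= u <= pi by apply/andP; split; lra.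
have su : sin u <= t by rewrite sin_le_asin_pi.
split=> //; rewrite u1 andbT leNgt; apply/negP => ual.
suff : sin al < sin u by lra.
rewrite -(sin_pisub al) -(sin_pisub u) ltr_sin ?in_itv/=; first lra.
- by apply/andP; split; lra.
- by apply/andP; split; lra.
Qed.

Lemma sublevel_sin_obtuse_r (al : R) g t : 0 < al -> pi / 2 < g -> al <= pi - g ->
  0 <= t -> t < sin g ->
  [set u | al <= u <= pi - g /\ sin u <= t] = `[al, asin t]%classic.
Proof.
move=> al0 g2 alg t0 tg; have tI : 0 <= t <= 1 by rewrite t0 /=; have := sin_le1 g; lra.
apply/seteqP; split => u /=; rewrite in_itv/=.
  move=> [/andP[u0 u1]]; rewrite sin_le_asin_pihalf ?u0//.
  by apply/andP; split; lra.
move=> /andP[u0 u1]; have T2 : asin t <= pi / 2 by apply: asin_lepi2; lra.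
have u2 : 0 <= u <= pi / 2 by apply/andP; split; lra.
have su : sin u <= t by rewrite sin_le_asin_pihalf.
split=> //; rewrite u0 /= leNgt; apply/negP => ual.
suff : sin g < sin u by lra.
rewrite -(sin_pisub g) ltr_sin ?in_itv/=; first lra.
- by apply/andP; split; lra.
- by apply/andP; split; lra.
Qed.

Lemma sublevel_sin_acute (al : R) g t : 0 < al -> 0 < g ->
  al <= pi / 2 -> g <= pi / 2 -> 0 <= t < 1 ->
  [set u | al <= u <= pi - g /\ sin u <= t] =
  `[al, asin t]%classic `|` `[pi - asin t, pi - g]%classic.
Proof.
move=> al0 g0 al2 g2 /andP[t0 t1]; have tI : 0 <= t <= 1 by lra.
have T2 : asin t <= pi / 2 by apply: asin_lepi2; lra.
apply/seteqP; split => u /=; rewrite !in_itv/=.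
  move=> [/andP[u0 u1]]; have [u2|/ltW u2] := leP u (pi / 2).
    by rewrite sin_le_asin_pihalf//; [move=> ?; left; rewrite u0|apply/andP; split; lra].
  by rewrite sin_le_asin_pi//; [move=> ?; right; rewrite u1 andbT|apply/andP; split; lra].
move=> [/andP[u0 u1]|/andP[u0 u1]].
  by rewrite u0 sin_le_asin_pihalf//; [split => //; lra|apply/andP; split; lra].
by rewrite u1 andbT sin_le_asin_pi//; [split => //; lra|apply/andP; split; lra].
Qed.

Lemma sublevel_sin_full (al : R) g t : 0 < al -> 0 < g -> al <= pi - g ->
  (if pi / 2 < al then sin al <= t else
   if pi / 2 < g then sin g <= t else 1 <= t) ->
  [set u | al <= u <= pi - g /\ sin u <= t] = `[al, pi - g]%classic.
Proof.
move=> al0 g0 alg H; apply/seteqP; split => u /=; rewrite in_itv/=; first by case.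
move=> /andP[u0 u1]; split; first by rewrite u0.
move: H; case: ltP => al2; [|case: ltP => g2]; apply: le_trans.
- rewrite -sin_pisub -(sin_pisub al) leNgt ltr_sin ?in_itv/= -?leNgt; first lra.
  + by apply/andP; split; lra.
  + by apply/andP; split; lra.
- rewrite -(sin_pisub g) leNgt ltr_sin ?in_itv/= -?leNgt; first lra.
  + by apply/andP; split; lra.
  + by apply/andP; split; lra.
- exact: sin_le1.
Qed.

Lemma sinsin_prim_pi_sub g : sinsin_prim g (pi - g) = ((pi - g) * cos g + sin g) / 2.
Proof. by rewrite /sinsin_prim subrK cospi sin_pisub; ring. Qed.

Lemma sinsin_prim_full (al : R) g :
  sinsin_prim g (pi - g) - sinsin_prim g al =
  2^-1 * ((pi - (al + g)) * cos g + cos al * sin (al + g)).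
Proof.
rewrite sinsin_prim_pi_sub /sinsin_prim.
have -> : sin g = sin (al + g - al) by congr sin; ring.
by rewrite sinB; field.
Qed.

Lemma integral_sinsin_right g t : 0 < g -> g <= pi / 2 -> 0 <= t <= 1 ->
  (\int[mu]_(u in `[(pi - asin t)%R, (pi - g)%R]) (sinsin g u)%:E =
  (2^-1 * ((sin g <= t)%R%:R *
    ((asin t - t * Num.sqrt (1 - t ^+ 2) - g) * cos g + (1 - t ^+ 2) * sin g)))%:E)%E.
Proof.
move=> g0 g2 tI; have tI' : -1 <= t <= 1 by lra.
rewrite sin_le_asin_pihalf//; last by apply/andP; split; lra.
case: leP => gT.
  rewrite mul1r integral_sinsin ?sinsin_prim_pi_sub; last lra.
  rewrite /sinsin_prim sin_pisub -cos_asin//.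
  have -> : pi - asin t + g = pi - (asin t - g) by ring.
  by rewrite cos_pisub cosB (asinK tI'); congr EFin; field.
by rewrite mul0r mulr0 set_itv_ge ?integral_set0// bnd_simp -ltNge; lra.
Qed.

Lemma integral_sinsin_left (al : R) g t : 0 < al -> al <= pi / 2 -> 0 <= t <= 1 ->
  (\int[mu]_(u in `[al, asin t]) (sinsin g u)%:E =
  (2^-1 * ((sin al <= t)%R%:R *
    ((asin t - t * Num.sqrt (1 - t ^+ 2) - al) * cos g + t ^+ 2 * sin g
      + sin al * cos (al + g))))%:E)%E.
Proof.
move=> al0 al2 tI; have tI' : -1 <= t <= 1 by lra.
rewrite sin_le_asin_pihalf//; last by apply/andP; split; lra.
case: leP => gT.
  rewrite mul1r integral_sinsin//.
  by rewrite /sinsin_prim -cos_asin// cosD (asinK tI'); congr EFin; field.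
by rewrite mul0r mulr0 set_itv_ge ?integral_set0// bnd_simp -ltNge.
Qed.

Lemma heavisideE x : heaviside x = (0 <= x)%R%:R.
Proof. by rewrite /heaviside; case: ifP. Qed.

(** The direction [u = al] is that of the side opposite to the apex.  Beyond it
    the end of the chord on the ray of length [a] reaches the end of the ray
    first, so that [l * sin u <= a * sin g] is the only constraint; the range
    stops at [pi - g], where the chord becomes parallel to the other ray. *)
Lemma integral_sinsin_rho_aB l (al be : R) g a b c :
  0 < l -> 0 < al -> 0 < be -> 0 < g -> al + be + g = pi ->
  0 < a -> 0 < b -> 0 < c -> c * sin al = a * sin g ->
  l != a -> l != c -> l != a * sin g ->
  (\int[mu]_(u in [set u | (al <= u <= pi - g)%R /\ (l * sin u <= a * sin g)%R])
      (sinsin g u)%:E = (sin g * rho_aB l al be g a b c)%:E)%E.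
Proof.
move=> l0 al0 be0 g0 sumpi a0 b0 c0 csin la lc las.
have gpi : g < pi by lra.
have alg : al <= pi - g by lra.
have sg0 : 0 < sin g by apply: sin_gt0_pi; rewrite g0.
pose t := a * sin g / l.
have t0 : 0 < t by rewrite divr_gt0// mulr_gt0.
have t0' := ltW t0.
have tE : 2 * (2^-1 * a * b * sin g) / (b * l) = t.
  by rewrite /t; field; rewrite !gt_eqF.
have dE : 2 * (2^-1 * a * b * sin g) / b = a * sin g by field; rewrite gt_eqF.
have cE : a * b / (4 * (2^-1 * a * b * sin g)) = (2 * sin g)^-1.
  by field; rewrite !gt_eqF.
have -> : [set u | al <= u <= pi - g /\ l * sin u <= a * sin g] =
          [set u | al <= u <= pi - g /\ sin u <= t].
  by apply/funext => u; rewrite /= ler_pdivlMr// [sin u * l]mulrC.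
(* [l <= c] and [l <= a] compare [t] with the sines at the ends [al] and [pi - g] of the range *)
have cl : (0 <= c - l) = (sin al <= t).
  by rewrite subr_ge0 ler_pdivlMr// -csin mulrC ler_pM2r// sin_gt0_pi// al0; lra.
have lc' : (0 <= l - c) = ~~ (0 <= c - l).
  by rewrite !subr_ge0 -ltNge le_eqVlt eq_sym (negbTE lc).
have al' : (0 <= a - l) = (sin g <= t).
  by rewrite subr_ge0 ler_pdivlMr// mulrC ler_pM2r.
have la' : (0 <= l - a) = ~~ (0 <= a - l).
  by rewrite !subr_ge0 -ltNge le_eqVlt eq_sym (negbTE la).
have sl : (0 <= a * sin g - l) = (1 <= t) by rewrite subr_ge0 ler_pdivlMr// mul1r.
have ls : (0 <= l - a * sin g) = ~~ (0 <= a * sin g - l).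
  by rewrite !subr_ge0 -ltNge le_eqVlt eq_sym (negbTE las).
have sinbe : sin be = sin (al + g) by rewrite -sin_pisub; congr sin; lra.
have cosbe : cos be = - cos (al + g) by rewrite -cos_pisub; congr cos; lra.
have beE : be = pi - (al + g) by lra.
have full : (if pi / 2 < al then sin al <= t else
    if pi / 2 < g then sin g <= t else 1 <= t) ->
  (\int[mu]_(u in [set u | (al <= u <= pi - g)%R /\ (sin u <= t)%R])
     (sinsin g u)%:E =
  (2^-1 * (be * cos g + cos al * sin be))%:E)%E.
  by move=> H; rewrite sublevel_sin_full// integral_sinsin// sinsin_prim_full -beE sinbe.
rewrite /rho_aB tE dE cE !heavisideE lc' la' ls cl al' sl.
rewrite [in RHS]mulrA invfM [sin g * _]mulrCA mulfV ?gt_eqF// mulr1.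
clear tE dE cE cl lc' al' la' sl ls csin la lc las.
move: full; have [al2|al2] := ltP (pi / 2) al.
  case: leP => [_ full|tal _]; first by rewrite full//= !(mul0r, mul1r, addr0).
  have tI : 0 <= t <= 1 by rewrite t0' /=; have := sin_le1 al; lra.
  rewrite sublevel_sin_obtuse_l// integral_sinsin_right//; last lra.
  by rewrite /= !(mul0r, mul1r, add0r).
have [g2|g2] := ltP (pi / 2) g.
  case: (leP (sin g)) => [_ full|tg _]; first by rewrite full//= !(mul0r, mul1r, addr0).
  have tI : 0 <= t <= 1 by rewrite t0' /=; have := sin_le1 g; lra.
  rewrite sublevel_sin_obtuse_r// integral_sinsin_left//.
  by rewrite /= !(mul0r, mul1r, add0r); congr EFin; rewrite cosD; ring.
case: (leP 1) => [_ full|t1 _].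
  by rewrite full//= !(mul0r, mulr0, mul1r, addr0).
have tI : 0 <= t <= 1 by rewrite t0' ltW.
rewrite sublevel_sin_acute//; last by rewrite t0'.
rewrite ge0_integral_setU//=; first last.
- apply/disj_setPS => u [] /=; rewrite !in_itv/= => /andP[_ ?] /andP[? _].
  suff : asin t < pi / 2 by lra.
  by apply: asin_ltpi2; rewrite t1 andbT; lra.
- move=> u Hu; rewrite lee_fin sinsin_ge0 ?g0//.
  have T2 : asin t <= pi / 2 by apply: asin_lepi2; lra.
  by case: Hu; rewrite in_itv/= => /andP[? ?]; apply/andP; split; lra.
- exact: measurable_sinsinE.
rewrite integral_sinsin_left// integral_sinsin_right// -EFinD; congr EFin.
by rewrite cosbe /=; ring.
Qed.

End TrigIntegral.

(** * Chords of given length between two sides of a triangle *)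

Section Sector.
Variable R : realType.
Notation mu := (@lebesgue_measure R).
Implicit Types (a b c g l t u x y : R).

Definition third_side a b g : R := Num.sqrt (a ^+ 2 + b ^+ 2 - 2 * a * b * cos g).

Definition opp_angle a b g : R := acos ((b - a * cos g) / third_side a b g).

Lemma third_sideC a b g : third_side b a g = third_side a b g.
Proof. by rewrite /third_side; congr Num.sqrt; ring. Qed.

Lemma rhoE a b g l : a != 0 -> b != 0 ->
  rho a b g l =
  rho_aB l (opp_angle a b g) (opp_angle b a g) g a b (third_side a b g) +
  rho_aB l (opp_angle b a g) (opp_angle a b g) g b a (third_side a b g).
Proof.
by move=> a0 b0; rewrite /rho (negbTE a0) (negbTE b0) /= /opp_angle (third_sideC a b).
Qed.

Lemma rhoC a b g l : rho a b g l = rho b a g l.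
Proof.
have [->|a0] := eqVneq a 0; first by rewrite /rho eqxx orbT.
have [->|b0] := eqVneq b 0; first by rewrite /rho eqxx orbT.
by rewrite !rhoE// addrC (third_sideC a b).
Qed.

Lemma third_side_sqr a b g :
  a ^+ 2 + b ^+ 2 - 2 * a * b * cos g = (b - a * cos g) ^+ 2 + (a * sin g) ^+ 2.
Proof.
have := cos2Dsin2 g => H.
transitivity (b ^+ 2 - 2 * a * b * cos g + a ^+ 2 * (cos g ^+ 2 + sin g ^+ 2)).
  by rewrite H; ring.
ring.
Qed.

Lemma triangle_angle a b g : 0 < a -> 0 < g < pi ->
  [/\ 0 < third_side a b g, 0 < opp_angle a b g < pi,
   third_side a b g * cos (opp_angle a b g) = b - a * cos g &
   third_side a b g * sin (opp_angle a b g) = a * sin g].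
Proof.
move=> a0 gpi; have sg := sin_gt0_pi gpi.
have as0 : 0 < a * sin g by rewrite mulr_gt0.
have sq0 : 0 < (b - a * cos g) ^+ 2 + (a * sin g) ^+ 2.
  by rewrite ltr_wpDl ?sqr_ge0// exprn_gt0.
have c0 : 0 < third_side a b g by rewrite /third_side third_side_sqr sqrtr_gt0.
have c2 : third_side a b g ^+ 2 = (b - a * cos g) ^+ 2 + (a * sin g) ^+ 2.
  by rewrite -third_side_sqr sqr_sqrtr// third_side_sqr ltW.
set c := third_side a b g in c0 c2 *.
set x := (b - a * cos g) / c.
have x1 : x ^+ 2 = 1 - (a * sin g / c) ^+ 2.
  rewrite !expr_div_n; have -> : (b - a * cos g) ^+ 2 = c ^+ 2 - (a * sin g) ^+ 2 by lra.
  by field; rewrite gt_eqF.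
have s0 : 0 < a * sin g / c by rewrite divr_gt0.
have xI : -1 < x < 1.
  rewrite -ltr_norml -(expr_lt1 (n := 2))// -normrX ger0_norm ?sqr_ge0// x1.
  by rewrite ltrBlDr ltrDl exprn_gt0.
have xI' : -1 <= x <= 1 by case/andP: xI => ? ?; apply/andP; split; exact: ltW.
split => //; rewrite /opp_angle -/c -/x.
- by rewrite acos_gt0 ?acos_ltpi//; case/andP: xI => ? ?; apply/andP; split => //; exact: ltW.
- by rewrite acosK ?in_itv// /x; field; rewrite gt_eqF.
- rewrite sin_acos// x1 opprB addrCA subrr addr0 sqrtr_sqr gtr0_norm//.
  by field; rewrite gt_eqF.
Qed.

Lemma triangle_angle_sum a b g : 0 < a -> 0 < b -> 0 < g < pi ->
  opp_angle a b g + opp_angle b a g + g = pi.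
Proof.
move=> a0 b0 gpi.
have [c0 /andP[al0 alpi] cc cs] := triangle_angle b a0 gpi.
have [_ /andP[be0 bepi] dc ds] := triangle_angle a b0 gpi.
rewrite (third_sideC a b) in dc ds.
set c := third_side a b g in c0 cc cs dc ds.
set al := opp_angle a b g in al0 alpi cc cs *.
set be := opp_angle b a g in be0 bepi dc ds *.
have sg := sin_gt0_pi gpi; have := cos2Dsin2 g => H.
have c2 : c ^+ 2 = a ^+ 2 + b ^+ 2 - 2 * a * b * cos g.
  rewrite /c sqr_sqrtr// third_side_sqr addr_ge0// sqr_ge0//.
have c20 : c ^+ 2 != 0 by rewrite gt_eqF// exprn_gt0.
have sab : sin (al + be) = sin g.
  apply: (mulfI c20); rewrite sinD.
  transitivity ((c * sin al) * (c * cos be) + (c * cos al) * (c * sin be)); first ring.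
  rewrite cc cs dc ds c2; ring.
have cab : cos (al + be) = - cos g.
  apply: (mulfI c20); rewrite cosD.
  transitivity ((c * cos al) * (c * cos be) - (c * sin al) * (c * sin be)); first ring.
  rewrite cc cs dc ds c2.
  transitivity (- (cos g * (a ^+ 2 + b ^+ 2 - 2 * a * b * cos g))
    - a * b * (cos g ^+ 2 + sin g ^+ 2 - 1)); first ring.
  by rewrite H; ring.
have lepi : al + be <= pi.
  rewrite leNgt; apply/negP => abpi.
  have : 0 < sin (al + be - pi) by apply: sin_gt0_pi; lra.
  by rewrite sinB sinpi cospi sab; lra.
move/andP: gpi => [g0 gpi].
suff : al + be = pi - g by lra.
apply: (@cos_inj R); rewrite ?in_itv/=; [lra..|].
by rewrite cab cosB sinpi cospi; ring.
Qed.

(** The directions in which a chord of length [l] between the two rays of an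
    angle [g] ends at distance at most [a] and at most [b] from the apex: by the
    law of sines these distances are [l * sin u / sin g] and
    [l * sin (u + g) / sin g]. *)
Definition sector g a b l : set R :=
  [set u | 0 <= u <= pi - g /\ l * sin u <= a * sin g /\
           l * sin (u + g) <= b * sin g].

Lemma measurable_sector g a b l : measurable (sector g a b l).
Proof.
have -> : sector g a b l = `[0, pi - g]%classic `&`
    ([set u | l * sin u <= a * sin g] `&` [set u | l * sin (u + g) <= b * sin g]).
  by apply/seteqP; split => u; rewrite /sector/= in_itv.
have ms : measurable_fun setT (fun u => l * sin u).
  by apply: measurable_funM => //; exact: measurable_sin.
have msg : measurable_fun setT (fun u => l * sin (u + g)).
  apply: measurable_funM => //; apply: (measurableT_comp (@measurable_sin R)).
  exact: measurable_funD.
apply: measurableI => //; apply: measurableI.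
  by rewrite -[X in measurable X]setTI; apply: measurable_fun_le.
by rewrite -[X in measurable X]setTI; apply: measurable_fun_le.
Qed.

(** The lengths at which the formula for [rho a b g] changes. *)
Definition exceptional_lengths a b g : seq R :=
  [:: a; b; third_side a b g; a * sin g; b * sin g].

Lemma integral_sector_degenerate a b g l : 0 < g < pi -> 0 < l ->
  (a == 0) || (b == 0) ->
  (\int[mu]_(u in sector g a b l) (sinsin g u)%:E = 0)%E.
Proof.
move=> /andP[g0 gpi] l0 ab0; apply: integral0_eq => u [/andP[u0 u1] [ua ub]].
congr EFin; rewrite /sinsin.
have su : 0 <= sin u by apply: sin_ge0_pi; lra.
have sug : 0 <= sin (u + g) by apply: sin_ge0_pi; lra.
case/orP: ab0 => /eqP ab0.
  move: ua; rewrite ab0 mul0r pmulr_rle0// => ua.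
  by rewrite (_ : sin u = 0) ?mul0r//; apply/eqP; rewrite eq_le ua.
move: ub; rewrite ab0 mul0r pmulr_rle0// => ub.
by rewrite (_ : sin (u + g) = 0) ?mulr0//; apply/eqP; rewrite eq_le ub.
Qed.

(** The direction parallel to the side opposite to the apex separates the chords
    for which the end on one ray is the binding constraint from those for which
    it is the end on the other; this is why [rho] is a sum of two symmetric
    terms. *)
Lemma integral_sector a b g l : 0 < g < pi -> 0 <= a -> 0 <= b -> 0 < l ->
  l \notin exceptional_lengths a b g ->
  (\int[mu]_(u in sector g a b l) (sinsin g u)%:E = (sin g * rho a b g l)%:E)%E.
Proof.
move=> gI a0 b0 l0; rewrite !inE !negb_or => /and5P[la lb lc las lbs].
have [ab0|] := boolP ((a == 0) || (b == 0)).
  by rewrite integral_sector_degenerate// /rho ab0 mulr0.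
rewrite negb_or => /andP[aN0 bN0].
have {}a0 : 0 < a by rewrite lt0r aN0.
have {}b0 : 0 < b by rewrite lt0r bN0.
have [c0 /andP[al0 alpi] cc cs] := triangle_angle b a0 gI.
have [_ /andP[be0 bepi] dc ds] := triangle_angle a b0 gI.
have sumpi := triangle_angle_sum a0 b0 gI.
rewrite (third_sideC a b) in dc ds.
have sg := sin_gt0_pi gI; case/andP: (gI) => g0 gpi.
rewrite rhoE//; set c := third_side a b g in c0 cc cs dc ds lc *.
set al := opp_angle a b g in al0 alpi cc cs sumpi *.
set be := opp_angle b a g in be0 bepi dc ds sumpi *.
rewrite mulrDr EFinD -(@integral_sinsin_rho_aB _ l al be g a b c)//.
rewrite -(@integral_sinsin_rho_aB _ l be al g b a c)//; last lra.
have mcap x y k : measurable [set u : R | x <= u <= pi - y /\ l * sin u <= k].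
  rewrite [X in measurable X](_ : _ = `[x, pi - y]%classic `&` [set u | l * sin u <= k]).
    apply: measurable_fun_le => //.
    by apply: measurable_funM => //; exact: measurable_funTS (@measurable_sin R).
  by apply/seteqP; split => u; rewrite /= in_itv.
rewrite -[X in (_ + X)%E](@ge0_integral_reflection _ (pi - g)); last 3 first.
- exact: mcap.
- exact: measurable_sinsinE.
- by move=> u [/andP[u0 u1] _]; rewrite lee_fin sinsin_ge0//; lra.
have sinsin_sym u : sinsin g (pi - g - u) = sinsin g u.
  rewrite /sinsin mulrC; congr (_ * _).
    by rewrite (_ : _ + _ = pi - u) ?sin_pisub//; ring.
  by rewrite (_ : _ - _ = pi - (u + g)) ?sin_pisub//; ring.
under [X in (_ = _ + X)%E]eq_integral do rewrite sinsin_sym.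
have key u : a * sin (u + g) - b * sin u = c * sin (al - u).
  have sbe : sin be = sin al * cos g + cos al * sin g.
    by rewrite -sinD -[in RHS]sin_pisub; congr sin; lra.
  apply: (mulfI (lt0r_neq0 sg)); rewrite sinD sinB.
  transitivity ((a * sin g) * (sin u * cos g + cos u * sin g) - (b * sin g) * sin u);
    first ring.
  rewrite -cs -ds sbe; ring.
have bind_b u : 0 <= u <= al -> l * sin (u + g) <= b * sin g -> l * sin u <= a * sin g.
  move=> /andP[u0 ual] ub; have /(mulr_ge0 (ltW c0)) : 0 <= sin (al - u).
    by apply: sin_ge0_pi; lra.
  rewrite -key subr_ge0 => H; rewrite -(ler_pM2l b0).
  have := ler_wpM2l (ltW l0) H; have := ler_wpM2l (ltW a0) ub; lra.
have bind_a u : al <= u <= pi - g -> l * sin u <= a * sin g -> l * sin (u + g) <= b * sin g.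
  move=> /andP[ual u0] ua; have /(mulr_ge0 (ltW c0)) : 0 <= sin (u - al).
    by apply: sin_ge0_pi; lra.
  rewrite -opprB sinN mulrN -key opprB subr_ge0 => H; rewrite -(ler_pM2l a0).
  have := ler_wpM2l (ltW l0) H; have := ler_wpM2l (ltW b0) ua; lra.
set B := _ @^-1` _.
have BE : B = [set u | 0 <= u <= al /\ l * sin (u + g) <= b * sin g].
  apply/funext => u; apply/propext; rewrite /B /=.
  have -> : sin (pi - g - u) = sin (u + g) by rewrite -sin_pisub; congr sin; ring.
  split=> -[/andP[u0 u1] ?]; split => //; lra.
have mB : measurable B.
  rewrite BE [X in measurable X](_ : _ = `[0, al]%classic `&`
    (setT `&` [set u | l * sin (u + g) <= b * sin g])); last first.
    by apply/funext => u; apply/propext; rewrite /= in_itv/=; split => [[]|[? []]].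
  apply: measurableI => //; apply: measurable_fun_le => //.
  apply: measurable_funM => //; apply: (measurableT_comp (@measurable_sin R)).
  exact: measurable_funD.
have mBal : measurable (B `\ al) by apply: measurableD.
rewrite -(@integral_setD1 _ _ al B)//; last exact: measurable_sinsinE.
rewrite -ge0_integral_setU//=.
- congr (integral _ _ _); rewrite BE; apply/seteqP; split => u /=.
    move=> [/andP[u0 u1] [ua ub]]; have [alu|ual] := leP al u; [left|right] => //.
    split; last by move=> ualE; rewrite ualE ltxx in ual.
    by split => //; apply/andP; split => //; exact: ltW.
  move=> [[uI ua]|[[uI ub] _]].
    split; last by split => //; exact: bind_a.
    by case/andP: uI => ? ?; lra.
  split; last by split => //; exact: bind_b.
  by case/andP: uI => ? ?; lra.
- exact: mcap.
- exact: measurable_sinsinE.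
- move=> u; rewrite BE /= => Hu; rewrite lee_fin sinsin_ge0//.
  by case: Hu => [[/andP[? ?] _]|[[/andP[? ?] _] _]]; lra.
- apply/disj_setPS => u [/= [uI _]]; rewrite BE /= => -[[/andP[_ u1] _]].
  by case; apply/eqP; rewrite eq_le u1 /=; case/andP: uI.
Qed.

Definition exceptional_box a a' b b' g : seq R :=
  exceptional_lengths a b g ++ exceptional_lengths a' b g ++
  exceptional_lengths a b' g ++ exceptional_lengths a' b' g.

Definition rho_rays a a' b b' g l : R :=
  rho a' b' g l - rho a b' g l - rho a' b g l + rho a b g l.

Lemma rho_raysC a a' b b' g l : rho_rays b b' a a' g l = rho_rays a a' b b' g l.
Proof. by rewrite /rho_rays !(rhoC b) !(rhoC b'); ring. Qed.

(** Inclusion-exclusion: each segment is the difference of two segments issued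
    from the apex. *)
Lemma integral_box a a' b b' g l : 0 < g < pi ->
  0 <= a -> a <= a' -> 0 <= b -> b <= b' -> 0 < l ->
  l \notin exceptional_box a a' b b' g ->
  (\int[mu]_(u in [set u | [/\ 0 <= u <= pi - g, a * sin g < l * sin u <= a' * sin g &
      b * sin g < l * sin (u + g) <= b' * sin g]%R]) (sinsin g u)%:E =
   (sin g * rho_rays a a' b b' g l)%:E)%E.
Proof.
move=> gI a0 aa' b0 bb' l0; rewrite /exceptional_box 3!mem_cat 3!negb_or.
move=> /and4P[lab la'b lab' la'b'].
have sg := sin_gt0_pi gI.
have Iab := integral_sector gI a0 b0 l0 lab.
have Ia'b := integral_sector gI (le_trans a0 aa') b0 l0 la'b.
have Iab' := integral_sector gI a0 (le_trans b0 bb') l0 lab'.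
have Ia'b' := integral_sector gI (le_trans a0 aa') (le_trans b0 bb') l0 la'b'.
pose A x : set R := [set u | l * sin u <= x * sin g].
have mA x : measurable (A x).
  rewrite -[X in measurable X]setTI; apply: measurable_fun_le => //.
  by apply: measurable_funM => //; exact: measurable_sin.
have ge0 (D : set R) x y : D `<=` sector g x y l ->
    forall u, D u -> (0%R <= (sinsin g u)%:E)%E.
  by move=> Dxy u /Dxy[ug _]; rewrite lee_fin sinsin_ge0.
have cutA y : (\int[mu]_(u in sector g a' y l) (sinsin g u)%:E =
    \int[mu]_(u in sector g a y l) (sinsin g u)%:E +
    \int[mu]_(u in sector g a' y l `\` A a) (sinsin g u)%:E)%E.
  rewrite -ge0_integral_setU//=.
  - congr (integral _ _ _); apply/seteqP; split => u.
      move=> ua'y; have [ua|ua] := pselect (A a u); last by right.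
      by left; case: ua'y => ? [_ ?].
    move=> [[? [ua ?]]|[]//]; split => //; split => //.
    by rewrite (le_trans ua)// ler_pM2r.
  - exact: measurable_sector.
  - by apply: measurableD; [exact: measurable_sector|exact: mA].
  - exact: measurable_sinsinE.
  - apply: (ge0 _ a' y) => u [[? [ua ?]]|[]//]; split => //; split => //.
    by rewrite (le_trans ua)// ler_pM2r.
  - by apply/disj_setPS => u [[_ [ua _]] [_ /(_ ua)]].
have sub : sector g a' b l `\` A a `<=` sector g a' b' l `\` A a.
  move=> u [[? [? ub]] ?]; split => //; split => //; split => //.
  by rewrite (le_trans ub)// ler_pM2r.
have cutB : (\int[mu]_(u in sector g a' b' l `\` A a) (sinsin g u)%:E =
    \int[mu]_(u in sector g a' b l `\` A a) (sinsin g u)%:E +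
    \int[mu]_(u in (sector g a' b' l `\` A a) `\` (sector g a' b l `\` A a))
      (sinsin g u)%:E)%E.
  have mD y : measurable (sector g a' y l `\` A a).
    by apply: measurableD; [exact: measurable_sector|exact: mA].
  rewrite -ge0_integral_setU//=.
  - by rewrite setDUK.
  - exact: mD.
  - by apply: measurableD; exact: mD.
  - exact: measurable_sinsinE.
  - move=> u Hu; apply: (ge0 (sector g a' b' l) a' b') => //.
    by case: Hu => [/sub[]|[[]]].
  - by apply/disj_setPS => u [? [_]].
move: cutB (cutA b) (cutA b'); rewrite Iab Ia'b Iab' Ia'b'.
set I1 := integral _ _ _; set I2 := integral _ _ _; set I3 := integral _ _ _ => E1 E2 E3.
have fin (x y : R) (z : \bar R) : (x%:E = y%:E + z -> z = (x - y)%:E)%E.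
  by case: z => [r| |]// [->]; congr EFin; ring.
have I1E := fin _ _ _ E3; have I2E := fin _ _ _ E2.
rewrite [I1]I1E [I2]I2E in E1; have {fin}I3E := fin _ _ _ E1.
transitivity I3; last by rewrite I3E /rho_rays; congr EFin; ring.
congr (integral _ _ _); apply/seteqP; split => u.
  move=> [u0 /andP[u1 u2] /andP[u3 u4]]; split.
    by split => //=; apply/negP; rewrite -ltNge.
  by move=> [[_ [_ ub]] _]; move: u3; rewrite ltNge ub.
move=> [[[u0 [u1 u2]] /= /negP]]; rewrite -ltNge => u3 u4; split => //; first by rewrite u3.
rewrite u2 andbT ltNge; apply/negP => ub; apply: u4; split => //.
by apply/negP; rewrite -ltNge.
Qed.

End Sector.

(** * Chords between two segments carried by rays with a common origin *)

Section Crossing.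
Variable R : realType.
Notation mu := (@lebesgue_measure R).
Implicit Types (th p l a b s t x y : R) (P O e f : plane R) (S T : plane R * plane R).

(** The coordinates of a point across and along the direction [th]. *)
Definition ht th P : R := P.2 * cos th - P.1 * sin th.
Definition tc th P : R := P.1 * cos th + P.2 * sin th.

(** The inequality is strict, so that a segment parallel to the line is never
    crossed, nor one with an end point on the line. *)
Definition crosses th p S : Prop := (ht th S.1 - p) * (ht th S.2 - p) < 0.

Definition cross_t th p S : R :=
  tc th S.1 + (p - ht th S.1) / (ht th S.2 - ht th S.1) * (tc th S.2 - tc th S.1).

(** A line of direction [th] is represented by its signed distance to the
    origin. *)
Definition cut_lines th S T (E : set R) : set R :=
  [set p | [/\ crosses th p S, crosses th p T & E `|cross_t th p S - cross_t th p T|]].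

(** The density [g] is a pointwise well-behaved version of [r]: at the lengths
    where its case changes an explicit formula takes arbitrary values, which
    disappear in the integral. *)
Definition pair_density S T (r : R -> R) : Prop :=
  exists g : R -> R, exists N : set R,
  [/\ measurable_fun [set: R] g, forall l, 0 <= g l, finite_set N,
      forall l, 0 < l -> ~ N l -> r l = g l &
      forall E : set R, measurable E -> E `<=` `]0, +oo[ ->
      [/\ forall th, measurable (cut_lines th S T E),
          measurable_fun [set: R] (fun th => mu (cut_lines th S T E)) &
          (\int[mu]_(th in `[0%R, pi[) mu (cut_lines th S T E) =
           \int[mu]_(l in E) (g l)%:E)%E]].

Lemma eq_pair_density S T S' T' (r r' : R -> R) :
  (forall th E, cut_lines th S T E = cut_lines th S' T' E) -> r =1 r' ->
  pair_density S T r -> pair_density S' T' r'.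
Proof.
move=> ST rr' [g [N [mg g0 fN rg H]]]; exists g, N; split => //.
  by move=> l l0 Nl; rewrite -rr' rg.
move=> E mE E0; have [H1 H2 H3] := H E mE E0.
by split => [th||]; [rewrite -ST|under eq_fun do rewrite -ST|
  under eq_integral do rewrite -ST].
Qed.

Lemma cut_linesC th S T E : cut_lines th S T E = cut_lines th T S E.
Proof. by apply/seteqP; split => p [? ?]; rewrite distrC => ?; split. Qed.

Lemma pair_densityC S T (r : R -> R) : pair_density S T r -> pair_density T S r.
Proof. by apply: eq_pair_density => // th E; exact: cut_linesC. Qed.

Lemma crosses_ht_neq th p S : crosses th p S -> ht th S.2 - ht th S.1 != 0.
Proof.
rewrite subr_eq0; apply: contraPneq => h; rewrite /crosses h.
by apply/negP; rewrite -leNgt -expr2 sqr_ge0.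
Qed.

Lemma cut_lines_flipl th S T E : cut_lines th (S.2, S.1) T E = cut_lines th S T E.
Proof.
have cS p : crosses th p (S.2, S.1) = crosses th p S by rewrite /crosses mulrC.
have tS p : crosses th p S -> cross_t th p (S.2, S.1) = cross_t th p S.
  move/crosses_ht_neq; rewrite /cross_t /= => n0.
  by field; rewrite n0 -opprB oppr_eq0.
apply/seteqP; split => p []; first by rewrite cS => cSp cTp; rewrite tS.
by move=> cSp cTp; rewrite -tS// => ?; split; rewrite ?cS.
Qed.

Definition ray_pt O e x : plane R := (O.1 + x * e.1, O.2 + x * e.2).

Lemma ht_ray th O e x : ht th (ray_pt O e x) = ht th O + x * ht th e.
Proof. by rewrite /ht /=; ring. Qed.

Lemma tc_ray th O e x : tc th (ray_pt O e x) = tc th O + x * tc th e.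
Proof. by rewrite /tc /=; ring. Qed.

Lemma det2_ht_tc th e f :
  det2 e f = tc th e * ht th f - ht th e * tc th f.
Proof.
rewrite /det2 /tc /ht.
transitivity ((e.1 * f.2 - e.2 * f.1) * (cos th ^+ 2 + sin th ^+ 2)); last by ring.
by rewrite cos2Dsin2 mulr1.
Qed.

Lemma crosses_ray th p O e a a' : a < a' ->
  crosses th p (ray_pt O e a, ray_pt O e a') <->
  ht th e != 0 /\ a < (p - ht th O) / ht th e < a'.
Proof.
move=> aa'; rewrite /crosses !ht_ray; set s := ht th e; set y := p - ht th O.
have -> : ht th O + a * s - p = a * s - y by rewrite /y; ring.
have -> : ht th O + a' * s - p = a' * s - y by rewrite /y; ring.
have [->|s0] := eqVneq s 0.
  split; last by case.
  by rewrite !mulr0 !sub0r mulrNN -expr2 ltNge sqr_ge0.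
have [z yE] : exists z, y = z * s by exists (y / s); field.
rewrite yE mulfK//.
have -> : (a * s - z * s) * (a' * s - z * s) = s ^+ 2 * ((a - z) * (a' - z)) by ring.
rewrite pmulr_rlt0 ?exprn_even_gt0//; split.
  move=> H; split => //; have [az|za] := ltP a z.
    by move: H; rewrite nmulr_rlt0 ?subr_lt0// subr_gt0 => ->.
  have : 0 <= (a - z) * (a' - z) by rewrite mulr_ge0; lra.
  lra.
by move=> [_ /andP[az za']]; rewrite nmulr_rlt0 ?subr_lt0// subr_gt0.
Qed.

Lemma cross_t_ray th p O e a a' : a < a' -> ht th e != 0 ->
  cross_t th p (ray_pt O e a, ray_pt O e a') =
  tc th O + (p - ht th O) / ht th e * tc th e.
Proof.
move=> aa' s0; rewrite /cross_t /= !ht_ray !tc_ray.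
have -> : ht th O + a' * ht th e - (ht th O + a * ht th e) = (a' - a) * ht th e by ring.
by field; rewrite s0 subr_eq0 gt_eqF.
Qed.

Lemma measurable_ht P : measurable_fun [set: R] (fun th => ht th P).
Proof.
apply: measurable_funB; apply: measurable_funM => //.
- exact: measurable_cos.
- exact: measurable_sin.
Qed.

(** A line does not distinguish a direction from its opposite, hence an angle in
    [[0, pi]] suffices. *)
Lemma unit_angle e : dot e e = 1 -> exists phi, exists eta : R,
  [/\ 0 <= phi <= pi, eta ^+ 2 = 1, e.1 = eta * cos phi & e.2 = eta * sin phi].
Proof.
move=> ee; pose eta : R := if 0 <= e.2 then 1 else -1.
have eta2 : eta ^+ 2 = 1 by rewrite /eta; case: ifP; rewrite ?expr1n ?sqrrN ?expr1n.
have sq : e.1 ^+ 2 + e.2 ^+ 2 = 1 by rewrite -ee /dot; ring.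
have xI : -1 <= eta * e.1 <= 1.
  rewrite -ler_norml -(expr_le1 (n := 2))// -normrX ger0_norm ?sqr_ge0//.
  by rewrite exprMn eta2 mul1r -sq lerDl sqr_ge0.
exists (acos (eta * e.1)), eta; split => //.
- by rewrite acos_ge0// acos_lepi.
- by rewrite acosK ?in_itv// mulrA -expr2 eta2 mul1r.
- rewrite sin_acos// exprMn eta2 mul1r -sq addrAC subrr add0r sqrtr_sqr.
  rewrite /eta; case: ifPn => e2; first by rewrite mul1r ger0_norm.
  by rewrite ltr0_norm ?mulN1r ?opprK// ltNge.
Qed.

End Crossing.

Section RayPair.
Variable R : realType.
Notation mu := (@lebesgue_measure R).
Variables (O e f : plane R) (a a' b b' : R).
Hypotheses (ee : dot e e = 1) (ff : dot f f = 1) (def : det2 e f < 0).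
Hypotheses (a0 : 0 <= a) (aa' : a < a') (b0 : 0 <= b) (bb' : b < b').

Let sg : R := - det2 e f.
Let S := (ray_pt O e a, ray_pt O e a').
Let T := (ray_pt O f b, ray_pt O f b').

(** Density of the lengths [l] with respect to [d th dl]: in a fixed direction
    the length cut off is proportional to the distance to [O]. *)
Let weight (th l : R) : R :=
  let s := ht th e in let t := ht th f in
  if [&& 0 < s * t, a * sg < l * `|t|, l * `|t| <= a' * sg,
         b * sg < l * `|s| & l * `|s| <= b' * sg]
  then s * t / sg else 0.

Let sg0 : 0 < sg. Proof. by rewrite /sg oppr_gt0. Qed.

Lemma cut_lines_raysE th (E : set R) : E `<=` `]0, +oo[ ->
  cut_lines th S T E =
  if 0 < ht th e * ht th f then
    (fun p => Num.sg (ht th e) * sg / (ht th e * ht th f) * p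
              + - (Num.sg (ht th e) * sg / (ht th e * ht th f) * ht th O)) @^-1`
    (E `&` [set l | [/\ a * sg < l * `|ht th f|, l * `|ht th f| < a' * sg,
         b * sg < l * `|ht th e| & l * `|ht th e| < b' * sg]])
  else set0.
Proof.
move=> E0; set s := ht th e; set t := ht th f.
have detE := det2_ht_tc th e f.
have lenE p : s != 0 -> t != 0 ->
    cross_t th p S - cross_t th p T = - (p - ht th O) * sg / (s * t).
  move=> s0 t0; rewrite !cross_t_ray//; rewrite -/s -/t /sg detE -/s -/t; field.
  by rewrite s0 t0.
have key p : s != 0 -> t != 0 -> 0 < s * t ->
  let y := p - ht th O in
  let l := Num.sg s * sg / (s * t) * p + - (Num.sg s * sg / (s * t) * ht th O) in
  l * `|t| = sg * (y / s) /\ l * `|s| = sg * (y / t) /\ (0 < y / s -> `|- y * sg / (s * t)| = l).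
  move=> s0 t0 st0 /=.
  have -> : Num.sg s * sg / (s * t) * p + - (Num.sg s * sg / (s * t) * ht th O) =
    Num.sg s * sg / (s * t) * (p - ht th O) by ring.
  set y := p - _.
  have [sp|sn] := ltP 0 s.
    have tp : 0 < t by rewrite -(pmulr_rgt0 _ sp).
    rewrite gtr0_sg// (gtr0_norm tp) (gtr0_norm sp); split; [|split]; [by field; rewrite s0 t0..|].
    move=> ys; have y0 : 0 < y by rewrite -(mulfVK s0 y) mulr_gt0.
    rewrite -normrN (_ : - _ = y * sg / (s * t)); last by ring.
    rewrite gtr0_norm; last by rewrite divr_gt0// mulr_gt0.
    by field; rewrite s0 t0.
  have {}sn : s < 0 by rewrite lt_neqAle s0.
  have tn : t < 0 by rewrite -(nmulr_rgt0 _ sn).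
  rewrite ltr0_sg// (ltr0_norm tn) (ltr0_norm sn); split; [|split]; [by field; rewrite s0 t0..|].
  move=> ys; have y0 : y < 0 by rewrite -(mulfVK s0 y) nmulr_llt0.
  rewrite ger0_norm; first by field; rewrite s0 t0.
  by rewrite ltW// divr_gt0// mulr_gt0// oppr_gt0.
case: ifPn => [st0|].
  have s0 : s != 0 by apply: contraTneq st0 => ->; rewrite mul0r ltxx.
  have t0 : t != 0 by apply: contraTneq st0 => ->; rewrite mulr0 ltxx.
  apply/seteqP; split => p /=; have /= [lt [ls len]] := key p s0 t0 st0.
    move=> [] /=; rewrite -/S -/T.
    move=> /(crosses_ray _ _ _ _ aa') [_ /andP[p1 p2]].
    move=> /(crosses_ray _ _ _ _ bb') [_ /andP[p3 p4]].
    rewrite lenE// len ?(le_lt_trans a0)// => El; split => //.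
    by rewrite lt ls ![_ * sg]mulrC !ltr_pM2l.
  move=> [El]; rewrite lt ls ![_ * sg]mulrC !ltr_pM2l// => -[p1 p2 p3 p4].
  split.
  - by apply/crosses_ray => //; split => //; apply/andP.
  - by apply/crosses_ray => //; split => //; apply/andP.
  - by rewrite lenE// len// (le_lt_trans a0).
move=> stN; apply/seteqP; split => p //=.
move=> [] /(crosses_ray _ _ _ _ aa') [s0 /andP[p1 _]].
move=> /(crosses_ray _ _ _ _ bb') [t0 /andP[p3 _]] _.
move/negP: stN; apply.
have : 0 < (p - ht th O) / s * ((p - ht th O) / t).
  by apply: mulr_gt0; [exact: le_lt_trans p1|exact: le_lt_trans p3].
rewrite -/s -/t in s0 t0 *.
have -> : (p - ht th O) / s * ((p - ht th O) / t) = (p - ht th O) ^+ 2 / (s * t) ^+ 2 * (s * t).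
  by field; rewrite s0 t0.
move=> H; have [//|stN] := ltP 0 (s * t).
have : (p - ht th O) ^+ 2 / (s * t) ^+ 2 * (s * t) <= 0.
  by rewrite mulr_ge0_le0// divr_ge0 ?sqr_ge0.
lra.
Qed.

Let measurable_weight : measurable_fun [set: R * R] (fun z : R * R => weight z.1 z.2).
Proof.
have mht P : measurable_fun [set: R * R] (fun z : R * R => ht z.1 P).
  exact: (measurableT_comp (measurable_ht P) measurable_fst).
have mn P : measurable_fun [set: R * R] (fun z : R * R => z.2 * `|ht z.1 P|).
  apply: measurable_funM; first exact: measurable_snd.
  exact: measurableT_comp (@normr_measurable R setT) (mht P).
apply: measurable_fun_ifT => //.
- apply: measurable_and; first by apply: measurable_fun_ltr => //; apply: measurable_funM.
  apply: measurable_and; first exact: measurable_fun_ltr.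
  apply: measurable_and; first exact: measurable_fun_ler.
  by apply: measurable_and; [exact: measurable_fun_ltr|exact: measurable_fun_ler].
- by do 2 apply: measurable_funM => //.
Qed.

Let weight_ge0 th l : 0 <= weight th l.
Proof.
rewrite /weight; case: ifPn => // /and5P[st _ _ _ _].
by rewrite ltW// divr_gt0.
Qed.

Lemma cut_lines_rays_measure th (E : set R) : measurable E -> E `<=` `]0, +oo[ ->
  measurable (cut_lines th S T E) /\
  (mu (cut_lines th S T E) = \int[mu]_(l in E) (weight th l)%:E)%E.
Proof.
move=> mE E0; rewrite cut_lines_raysE//.
set s := ht th e; set t := ht th f.
case: ifPn => [st0|/negbTE st0]; last first.
  split=> //; rewrite measure0; apply/esym/integral0_eq => l _.
  by rewrite /weight -/s -/t st0.
set I := [set l | _].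
have ml x : measurable_fun [set: R] (fun l => l * `|x|) by apply: measurable_funM.
have mI : measurable I.
  rewrite [I](_ : _ = [set l | [&& a * sg < l * `|t|, l * `|t| < a' * sg,
         b * sg < l * `|s| & l * `|s| < b' * sg]]); last first.
    by apply/seteqP; split => l /and4P.
  apply: measurable_setb; apply: measurable_and; first exact: measurable_fun_ltr.
  apply: measurable_and; first exact: measurable_fun_ltr.
  by apply: measurable_and; exact: measurable_fun_ltr.
pose J := [set l | [&& a * sg < l * `|t|, l * `|t| <= a' * sg,
         b * sg < l * `|s| & l * `|s| <= b' * sg]].
have mJ : measurable J.
  apply: measurable_setb; apply: measurable_and; first exact: measurable_fun_ltr.
  apply: measurable_and; first exact: measurable_fun_ler.
  by apply: measurable_and; [exact: measurable_fun_ltr|exact: measurable_fun_ler].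
have s0 : s != 0 by apply: contraTneq st0 => ->; rewrite mul0r ltxx.
have t0 : t != 0 by apply: contraTneq st0 => ->; rewrite mulr0 ltxx.
set c := Num.sg s * sg / (s * t).
have cn : `|c| = sg / (s * t).
  by rewrite !normrM normr_sg s0 mul1r gtr0_norm// normfV gtr0_norm.
have c0 : c != 0 by rewrite -normr_eq0 cn gt_eqF// divr_gt0.
have mEI : measurable (E `&` I) by exact: measurableI.
split.
  rewrite -[X in measurable X]setTI.
  by apply: (measurable_funD (measurable_funM _ _) _) => //.
rewrite lebesgue_measure_affine// cn invf_div.
have -> : mu (E `&` I) = mu (E `&` J).
  apply: (@lebesgue_measure_eq_off_finite _ _ _
    [set a' * sg / `|t|; b' * sg / `|s|]) => //; first exact: measurableI.
  apply/seteqP; split => l [[El]] /=.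
    move=> [h1 h2 h3 h4] N; split => //; split => //.
    by apply/and4P; split => //; exact: ltW.
  move=> /and4P[h1 h2 h3 h4] N; split => //; split => //; split => //.
    rewrite lt_neqAle h2 andbT; apply: contra_notN N => /eqP <-.
    by left; rewrite mulfK// normr_eq0.
  rewrite lt_neqAle h4 andbT; apply: contra_notN N => /eqP <-.
  by right; rewrite mulfK// normr_eq0.
rewrite -integral_cst; last exact: measurableI.
rewrite integral_mkcondr; apply: eq_integral => l _.
rewrite patchE /weight -/s -/t st0 /=; case: ifPn => [|lJ].
  by rewrite inE => ->.
by rewrite ifN//; apply: contraNN lJ => ?; rewrite inE.
Qed.

Let gamma := acos (dot e f).

Lemma gamma_facts : [/\ 0 < gamma < pi, cos gamma = dot e f & sin gamma = sg].
Proof.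
have cs : dot e f ^+ 2 + sg ^+ 2 = 1.
  transitivity (dot e e * dot f f); last by rewrite ee ff mulr1.
  by rewrite /sg /dot /det2; ring.
have dI : -1 < dot e f < 1.
  rewrite -ltr_norml -(expr_lt1 (n := 2))// -normrX ger0_norm ?sqr_ge0//.
  by rewrite -cs ltrDl exprn_gt0.
have dI' : -1 <= dot e f <= 1 by lra.
split; rewrite /gamma.
- by rewrite acos_gt0 ?acos_ltpi//; lra.
- by rewrite acosK// in_itv.
- by rewrite sin_acos// -cs addrAC subrr add0r sqrtr_sqr gtr0_norm.
Qed.

Let rot_weight (u l : R) : R :=
  let s := sin u in let t := sin (u + gamma) in
  if [&& 0 < s * t, a * sg < l * `|t|, l * `|t| <= a' * sg,
         b * sg < l * `|s| & l * `|s| <= b' * sg]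
  then s * t / sg else 0.

Lemma weight_rotation : exists2 phi, 0 <= phi <= pi &
  forall th l, weight th l = rot_weight (th - phi) l.
Proof.
have [phi [eta [phiI eta2 e1 e2]]] := unit_angle ee.
have [gI cg sg_] := gamma_facts.
exists phi => // th l; rewrite /weight /rot_weight /=.
have sE : ht th e = - eta * sin (th - phi).
  by rewrite /ht e1 e2 sinB; ring.
have cE : tc th e = eta * cos (th - phi).
  by rewrite /tc e1 e2 cosB; ring.
have fE : ht th f = cos gamma * ht th e - sin gamma * tc th e.
  rewrite cg sg_ /sg.
  transitivity ((e.1 ^+ 2 + e.2 ^+ 2) * ht th f).
    by rewrite (_ : _ + _ = dot e e) ?ee ?mul1r// /dot; ring.
  by rewrite /dot /det2 /ht /tc; ring.
have tE : ht th f = - eta * sin (th - phi + gamma).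
  by rewrite fE sE cE (sinD (th - phi)); ring.
have eta1 : `|- eta| = 1.
  by apply/eqP; rewrite -(eqrXn2 (n := 2))// -normrX sqrrN eta2 expr1n normr1.
have stE : ht th e * ht th f = sin (th - phi) * sin (th - phi + gamma).
  rewrite sE tE; transitivity (eta ^+ 2 * (sin (th - phi) * sin (th - phi + gamma))).
    by ring.
  by rewrite eta2 mul1r.
have ns : `|ht th e| = `|sin (th - phi)| by rewrite sE normrM eta1 mul1r.
have nt : `|ht th f| = `|sin (th - phi + gamma)| by rewrite tE normrM eta1 mul1r.
by rewrite stE ns nt.
Qed.

(** In terms of the angle with the first ray, the admissible directions are those
    of [integral_box], with the roles of the two rays exchanged because the chord
    end on one ray is controlled by the angle with the other. *)
Lemma integral_weight l : 0 < l -> l \notin exceptional_box b b' a a' gamma ->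
  (\int[mu]_(th in `[0%R, pi[) (weight th l)%:E =
   (rho_rays a a' b b' gamma l)%:E)%E.
Proof.
move=> l0 lN; have [gI cg sg_] := gamma_facts.
have [phi phiI wE] := weight_rotation.
under eq_integral do rewrite wE.
have mrot : measurable_fun [set: R] (fun u => (rot_weight u l)%:E).
  apply/measurable_EFinP.
  have -> : (fun u => rot_weight u l) = (fun u => weight (u + phi) l).
    by apply/funext => u; rewrite wE addrK.
  have mwl : measurable_fun [set: R] (fun th => weight th l).
    exact: (measurableT_comp measurable_weight (measurable_fun_pair
      (@measurable_id _ R setT) (measurable_cst l))).
  by apply: (measurableT_comp mwl); exact: measurable_funD.
rewrite (@ge0_integral_periodic _ pi phi (fun u => (rot_weight u l)%:E))//; first last.
- move=> u; rewrite /rot_weight addrAC !sinDpi.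
  by rewrite !normrN mulrNN.
- by move=> u; rewrite lee_fin -[u](addrK phi) -wE.
have := integral_box gI b0 (ltW bb') a0 (ltW aa') l0 lN.
rewrite sg_; set B := [set u | _] => HB.
transitivity (\int[mu]_(u in B) ((sg^-1)%:E * (sinsin gamma u)%:E))%E; last first.
  rewrite ge0_integralZl//=.
  - rewrite HB -EFinM; congr EFin; rewrite mulKf ?gt_eqF//.
    exact: rho_raysC.
  - rewrite [B](_ : _ = setT `&` [set u | [&& 0 <= u <= pi - gamma,
        b * sg < l * sin u <= b' * sg & a * sg < l * sin (u + gamma) <= a' * sg]]).
    + rewrite setTI; apply: measurable_setb.
      have m1 : measurable_fun [set: R] (fun u => l * sin u).
        by apply: measurable_funM => //; exact: measurable_sin.
      have m2 : measurable_fun [set: R] (fun u => l * sin (u + gamma)).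
        apply: measurable_funM => //; apply: (measurableT_comp (@measurable_sin R)).
        exact: measurable_funD.
      have mI (x y : R) (h : R -> R) : measurable_fun [set: R] h ->
          measurable_fun [set: R] (fun u => x < h u <= y).
        by move=> mh; apply: measurable_and; [exact: measurable_fun_ltr|
          exact: measurable_fun_ler].
      apply: measurable_and; last by apply: measurable_and; exact: mI.
      by apply: measurable_and; exact: measurable_fun_ler.
    + by rewrite setTI; apply/seteqP; split => u /and3P.
  - exact: measurable_sinsinE.
  - by move=> u [uI _ _]; rewrite lee_fin sinsin_ge0.
  - by rewrite lee_fin invr_ge0 ltW.
rewrite integral_mkcond [RHS]integral_mkcond; apply: eq_integral => u _.
case/andP: (gI) => g0 gpi.
rewrite !patchE; have [uB|uB] := boolP (u \in B).
  move: (uB); rewrite inE => -[/andP[u0 u1] /andP[u2 u3] /andP[u4 u5]].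
  have su : 0 <= sin u by apply: sin_ge0_pi; lra.
  have sug : 0 <= sin (u + gamma) by apply: sin_ge0_pi; lra.
  rewrite ifT; last by rewrite inE /= in_itv/=; lra.
  rewrite /rot_weight !ger0_norm// u2 u3 u4 u5 !andbT /sinsin -EFinM; congr EFin.
  case: ifPn => [_|]; first by rewrite mulrC.
  rewrite -leNgt => st; rewrite (_ : sin u * sin (u + gamma) = 0) ?mulr0//.
  by apply/eqP; rewrite eq_le st mulr_ge0.
case: ifPn => [|//]; rewrite inE /= in_itv/= => /andP[u0 upi].
rewrite /rot_weight; case: ifPn => // /and5P[st h1 h2 h3 h4].
have su : 0 <= sin u by apply: sin_ge0_pi; lra.
have su0 : 0 < sin u.
  by rewrite lt_neqAle su andbT eq_sym; apply: contraTneq st => ->; rewrite mul0r ltxx.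
have sug0 : 0 < sin (u + gamma) by rewrite -(pmulr_rgt0 _ su0).
case/negP: uB; rewrite inE /B /=.
rewrite !gtr0_norm// in h1 h2 h3 h4.
split; [|by apply/andP..].
rewrite u0 /= leNgt; apply/negP => ug.
have : 0 <= sin (u + gamma - pi) by apply: sin_ge0_pi; lra.
by rewrite sinB sinpi cospi; lra.
Qed.

(** Tonelli's theorem makes the length the outer variable. *)
Lemma pair_density_rays_clockwise : pair_density S T (rho_rays a a' b b' gamma).
Proof.
have mD : measurable (`[0, pi[%classic : set R) by exact: measurable_itv.
pose h l := (\int[mu]_(th in `[0%R, pi[) (weight th l)%:E)%E.
have mh : measurable_fun [set: R] h.
  by have [_ []] := ge0_tonelli_sets mD (@measurableT _ R) measurable_weight weight_ge0.
have h0 l : (0 <= h l)%E by apply: integral_ge0 => th _; rewrite lee_fin.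
exists (fun l => fine (h l)), [set` exceptional_box b b' a a' gamma]; split.
- exact: measurableT_comp.
- by move=> l; exact: fine_ge0.
- exact: finite_seq.
- by move=> l l0 /= /negP lN; rewrite /h integral_weight.
- move=> E mE E0; have HE th := cut_lines_rays_measure th mE E0.
  have [m1 [_ tonelli]] := ge0_tonelli_sets mD mE measurable_weight weight_ge0.
  split; first by move=> th; have [] := HE th.
    by under eq_fun do rewrite (HE _).2.
  under eq_integral do rewrite (HE _).2.
  rewrite tonelli.
  apply: (@integral_eq_off_finite _ E [set` exceptional_box b b' a a' gamma]).
  + exact: mE.
  + exact: finite_seq.
  + exact: (measurable_funTS mh).
  + apply: measurable_funTS; apply/measurable_EFinP; exact: measurableT_comp.
  + move=> l /E0; rewrite /= in_itv/= andbT => l0 /negP lN.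
    by rewrite -/(h l) /h integral_weight.
Qed.

End RayPair.

(** * Two segments that are not parallel *)

Section NonParallel.
Variable R : realType.
Implicit Types (a b x y : R) (P Q O V e f : plane R) (S T : plane R * plane R).

Lemma pair_density_rays O e f a a' b b' :
  dot e e = 1 -> dot f f = 1 -> det2 e f != 0 ->
  0 <= a -> a < a' -> 0 <= b -> b < b' ->
  pair_density (ray_pt O e a, ray_pt O e a') (ray_pt O f b, ray_pt O f b')
    (rho_rays a a' b b' (acos (dot e f))).
Proof.
move=> ee ff; rewrite neq_lt => /orP[def|def] a0 aa' b0 bb'.
  exact: pair_density_rays_clockwise.
have {}def : det2 f e < 0 by rewrite -oppr_gt0 (_ : - _ = det2 e f)// /det2; ring.
apply: pair_densityC.
apply: (eq_pair_density _ _ (pair_density_rays_clockwise O ff ee def b0 bb' a0 aa')) => // l.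
rewrite (_ : dot f e = dot e f); last by rewrite /dot; ring.
exact: rho_raysC.
Qed.

Lemma enorm_gt0 V : V != (0, 0) -> 0 < enorm V.
Proof.
case: V => x y; rewrite xpair_eqE negb_and /enorm /dot /= sqrtr_gt0 -!expr2 => xy0.
rewrite lt_neqAle addr_ge0 ?sqr_ge0// andbT eq_sym paddr_eq0 ?sqr_ge0//.
by rewrite !sqrf_eq0 negb_and.
Qed.

Lemma enorm_sqr V : enorm V ^+ 2 = dot V V.
Proof. by rewrite sqr_sqrtr// /dot -!expr2 addr_ge0// sqr_ge0. Qed.

Lemma enorm_scale V x : enorm (x * V.1, x * V.2) = `|x| * enorm V.
Proof.
rewrite /enorm (_ : dot _ _ = x ^+ 2 * dot V V); last by rewrite /dot /=; ring.
by rewrite sqrtrM ?sqr_ge0// sqrtr_sqr.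
Qed.

Lemma edist_ray O V x : edist O (ray_pt O V x) = `|x| * enorm V.
Proof.
by rewrite /edist -enorm_scale /vec /=; congr (enorm (_, _)); ring.
Qed.

(** Two points of a line on the same side of [O], the farther one giving its
    direction to the ray. *)
Lemma common_ray O V x y : V != (0, 0) -> `|x| < `|y| -> 0 <= x * y ->
  exists2 e, dot e e = 1 &
  [/\ ray_pt O V x = ray_pt O e (`|x| * enorm V),
      ray_pt O V y = ray_pt O e (`|y| * enorm V) &
      exists2 k, k != 0 & e = (k * V.1, k * V.2)].
Proof.
move=> V0 xy xy0; have m0 := enorm_gt0 V0.
have y0 : y != 0 by rewrite -normr_gt0 (le_lt_trans _ xy).
have k0 : Num.sg y / enorm V != 0 by rewrite mulf_neq0 ?sgr_eq0// invr_eq0 gt_eqF.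
have xE : `|x| * Num.sg y = x.
  have [->|x0] := eqVneq x 0; first by rewrite normr0 mul0r.
  have {}xy0 : 0 < x * y by rewrite lt0r mulf_neq0.
  have := sgrM x y; rewrite (gtr0_sg xy0) => /esym sxy.
  rewrite normrEsg -mulrA [x * _]mulrC mulrA sxy mul1r//.
exists (Num.sg y / enorm V * V.1, Num.sg y / enorm V * V.2).
  transitivity ((Num.sg y) ^+ 2 * (dot V V / enorm V ^+ 2)).
    by rewrite /dot /=; field; rewrite gt_eqF.
  rewrite sqr_sg y0 mul1r enorm_sqr divff//.
  by rewrite -enorm_sqr expf_neq0// gt_eqF.
split; last by exists (Num.sg y / enorm V).
- rewrite -{1}xE /ray_pt /=; congr (_ + _, _ + _); field; exact: lt0r_neq0.
- rewrite {1}(numEsg y) /ray_pt /=; congr (_ + _, _ + _);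
    field; exact: lt0r_neq0.
Qed.

Definition sides_param S T : R := det2 (vec S.1 T.1) (vec T.1 T.2) / sides_N S T.

Lemma sides_O_param S T : sides_N S T != 0 ->
  S.1 = ray_pt (sides_O S T) (vec S.1 S.2) (- sides_param S T) /\
  S.2 = ray_pt (sides_O S T) (vec S.1 S.2) (1 - sides_param S T).
Proof.
case: S => [[ax ay] [bx by_]]; case: T => [[cx cy] [dx dy]].
rewrite /sides_O /sides_param /ray_pt /vec.
set N := sides_N _ _; rewrite /= => N0.
rewrite /det2 /=.
have NE : N = (bx - ax) * (dy - cy) - (by_ - ay) * (dx - cx) by [].
split; congr (_, _); rewrite NE; field; rewrite -NE//.
Qed.

Lemma sides_OC S T : sides_O S T = sides_O T S.
Proof.
case: S => [[ax ay] [bx by_]]; case: T => [[cx cy] [dx dy]].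
rewrite /sides_O (_ : sides_N (cx, cy, (dx, dy)) _ = - sides_N (ax, ay, (bx, by_)) (cx, cy, (dx, dy)));
  last by rewrite /sides_N /det2 /=; ring.
by rewrite invrN; congr (_, _); rewrite mulrN -mulNr; congr (_ / _); ring.
Qed.

Definition weakly_separates T S : Prop :=
  0 <= det2 (vec T.1 T.2) (vec T.1 S.1) * det2 (vec T.1 T.2) (vec T.1 S.2).

(** This is where convexity enters: [O] is not strictly between the end points of
    [S], hence [S] lies on a ray from [O], whose direction is that of the farther
    end point. *)
Lemma labelled_ray S T : sides_N S T != 0 -> weakly_separates T S ->
  let O := sides_O S T in
  exists2 e, dot e e = 1 & exists a, exists a', [/\ 0 <= a, a < a',
    label_from O S = (ray_pt O e a, ray_pt O e a') &
    exists2 k, k != 0 & e = (k * (vec S.1 S.2).1, k * (vec S.1 S.2).2)].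
Proof.
move=> N0 ws O; have [S1 S2] := sides_O_param N0.
have S1O : S.1 = ray_pt O (vec S.1 S.2) (- sides_param S T) := S1.
have S2O : S.2 = ray_pt O (vec S.1 S.2) (1 - sides_param S T) := S2.
have N0' : sides_N T S != 0.
  by rewrite (_ : _ T S = - sides_N S T) ?oppr_eq0// /sides_N /det2; ring.
have [T1 _] := sides_O_param N0'; rewrite -sides_OC -/O in T1.
move: S1O S2O T1 ws; rewrite /weakly_separates.
set x := - sides_param S T; set y := 1 - _; set V := vec S.1 S.2.
set W := vec T.1 T.2; set z := - _ => S1O S2O T1 ws.
have detx t : det2 W (vec T.1 (ray_pt O V t)) = - t * sides_N S T.
  by rewrite T1 /sides_N -/V -/W /det2 /vec /ray_pt /=; ring.
have xy0 : 0 <= x * y.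
  move: ws; rewrite {1}S1O S2O !detx.
  rewrite (_ : - x * _ * _ = x * y * sides_N S T ^+ 2); last by ring.
  by rewrite pmulr_lge0// exprn_even_gt0.
have V0 : V != (0, 0).
  apply: contraNneq N0 => V0; rewrite /sides_N -/V V0 /det2 /=.
  by rewrite !mul0r subrr.
have m0 := enorm_gt0 V0.
have yx : y = x + 1 by rewrite /y /x addrC.
have xNy : `|x| != `|y|.
  apply/eqP => xy; have xy2 : x ^+ 2 = y ^+ 2.
    by rewrite -[x ^+ 2]real_normK ?num_real// xy real_normK ?num_real.
  have xh : x = - 2^-1 by move: xy2; rewrite yx; lra.
  by move: xy0; rewrite yx xh; lra.
rewrite /label_from {1}S1O {1}S2O !edist_ray ltr_pM2r//; case: ifPn => [xy|].
  have [e ee [e1 e2 [k k0 ek]]] := common_ray O V0 xy xy0.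
  exists e => //; exists (`|x| * enorm V), (`|y| * enorm V); split.
  - by rewrite mulr_ge0// ltW.
  - by rewrite ltr_pM2r.
  - by rewrite -e1 -e2 -S1O -S2O; case: (S).
  - by exists k.
rewrite -leNgt le_eqVlt eq_sym (negbTE xNy) /= => yx'.
have [e ee [e1 e2 [k k0 ek]]] := common_ray O V0 yx' ltac:(by rewrite mulrC).
exists e => //; exists (`|y| * enorm V), (`|x| * enorm V); split.
- by rewrite mulr_ge0// ltW.
- by rewrite ltr_pM2r.
- by rewrite -e1 -e2 -S1O -S2O.
- by exists k.
Qed.

Lemma cut_lines_label th O S T E :
  cut_lines th (label_from O S) T E = cut_lines th S T E.
Proof. by rewrite /label_from; case: ifP => // _; exact: cut_lines_flipl. Qed.

Lemma pair_density_nonparallel S T : sides_N S T != 0 ->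
  weakly_separates S T -> weakly_separates T S ->
  pair_density S T (rho_pair S T).
Proof.
move=> N0 wST wTS.
have N0' : sides_N T S != 0.
  by rewrite (_ : _ T S = - sides_N S T) ?oppr_eq0// /sides_N /det2; ring.
have [e ee [a [a' [a0 aa' Sl [k k0 ek]]]]] := labelled_ray N0 wTS.
have := labelled_ray N0' wST; rewrite -sides_OC => -[f ff [b [b' [b0 bb' Tl [m m0 fm]]]]].
set O := sides_O S T in Sl Tl.
have def : det2 e f != 0.
  rewrite (_ : det2 e f = k * m * sides_N S T) ?mulf_neq0// ek fm /sides_N /det2 /=.
  by ring.
apply: eq_pair_density (pair_density_rays O ee ff def a0 aa' b0 bb').
  move=> th E; rewrite -Sl -Tl cut_lines_label cut_linesC cut_lines_label.
  exact: cut_linesC.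
move=> l; rewrite /rho_pair (negbTE N0) /rho_nonparallel -/O Sl Tl.
have e1 : enorm e = 1 by rewrite /enorm ee sqrtr1.
have f1 : enorm f = 1 by rewrite /enorm ff sqrtr1.
have a'0 := le_trans a0 (ltW aa'); have b'0 := le_trans b0 (ltW bb').
rewrite !edist_ray e1 f1 !mulr1 !ger0_norm//.
rewrite (_ : dot (vec _ _) (vec _ _) / _ = dot e f)//.
have vE P h x y : vec (ray_pt P h x) (ray_pt P h y) = ((y - x) * h.1, (y - x) * h.2).
  by rewrite /vec /ray_pt /=; congr (_, _); ring.
rewrite !vE !enorm_scale e1 f1 !mulr1 !gtr0_norm ?subr_gt0//.
by rewrite /dot /=; field; rewrite !subr_eq0 !gt_eqF.
Qed.

End NonParallel.

(** * The change of variable from angles to lengths between parallels *)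

Section Cosecant.
Variable R : realType.
Notation mu := (@lebesgue_measure R).
Notation mR := (measurableTypeR R).

(** An integral is made a measure in order to apply uniqueness of measures. *)
Lemma density_measure (F : R -> \bar R) :
  measurable_fun [set: R] F -> (forall x, 0 <= F x)%E ->
  {m : {measure set mR -> \bar R} | forall E, m E = (\int[mu]_(x in E) F x)%E}.
Proof.
move=> mF F0; pose m (E : set mR) := (\int[mu]_(x in E) F x)%E.
have m0 : m set0 = 0%E by exact: integral_set0.
have mge0 E : (0 <= m E)%E by apply: integral_ge0.
have madd : semi_sigma_additive m.
  move=> A mA tA mUA; rewrite /m ge0_integral_bigcup//.
    by apply: is_cvg_ereal_nneg_natsum_cond => n _ _; exact: mge0.
  exact: measurable_funTS.
pose M : {measure set mR -> \bar R} :=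
  HB.pack m (isMeasure.Build _ _ _ m m0 mge0 madd).
by exists M.
Qed.

(** The densities considered here blow up at the end point of the half-line, so
    that agreement and finiteness are only available away from it; continuity
    from below gives the rest. *)
Lemma eq_measure_open_ray (m1 m2 : {measure set mR -> \bar R}) (d : R) :
  (forall x y, d < x -> x < y -> m1 `]x, y]%classic = m2 `]x, y]%classic) ->
  (forall x y, d < x -> x < y -> (m1 `]x, y]%classic < +oo)%E) ->
  forall E : set mR, measurable E -> E `<=` `]d, +oo[ -> m1 E = m2 E.
Proof.
move=> m12 fin E mE Ed.
pose D n : set mR := `]d + n.+1%:R^-1, +oo[%classic.
have mD n : measurable (D n) by exact: measurable_itv.
have dn n : d < d + n.+1%:R^-1 by rewrite ltrDl invr_gt0.
have DI n (x y : R) : `]x, y] `&` D n = `](Num.max x (d + n.+1%:R^-1)), y]%classic.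
  apply/seteqP; split => z; rewrite /D /= !in_itv/= andbT gt_max.
    by move=> [/andP[-> ->] ->].
  by move=> /andP[/andP[-> ->] ->].
have key n A : measurable A -> m1 (A `&` D n) = m2 (A `&` D n).
  move=> mA; pose r1 := mrestr m1 (mD n); pose r2 := mrestr m2 (mD n).
  have r12 (x y : R) : r1 `]x, y]%classic = r2 `]x, y]%classic.
    rewrite /r1 /r2 /mrestr DI; set z := Num.max _ _.
    have dz : d < z by rewrite lt_max (dn n) orbT.
    have [zy|yz] := ltP z y; first exact: m12.
    by rewrite set_itv_ge ?measure0// bnd_simp -leNgt.
  apply: (@measure_unique _ R mR (@ocitv R) (fun k => `](- k%:R), k%:R]%classic) _ _ _ _ r1 r2) => //.
  - by move=> X Y; exact: ocitvI.
  - move=> k; exists (- k%:R, k%:R) => //.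
  - apply/seteqP; split => // x _.
    have := archi_boundP (normr_ge0 x); set k := Num.bound _ => xk.
    by exists k => //=; rewrite in_itv/=; move: xk; rewrite ltr_norml; lra.
  - by move=> X [[x y] _ <-]; exact: r12.
  - move=> k; change (m1 (`](- k%:R : R)%R, (k%:R)%R]%classic `&` D n) < +oo)%E.
    rewrite DI; set z := Num.max _ _.
    have dz : d < z by rewrite lt_max (dn n) orbT.
    have [zy|yz] := ltP z (k%:R : R); first exact: fin.
    by rewrite set_itv_ge ?measure0// bnd_simp -leNgt.
have EE : E = \bigcup_n (E `&` D n).
  rewrite -setI_bigcupr; apply/esym/setIidl => x /Ed; rewrite /= in_itv/= andbT => dx.
  have dx' : 0 <= (x - d)^-1 by rewrite invr_ge0 subr_ge0 ltW.
  have := archi_boundP dx'; set k := Num.bound _ => xk.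
  exists k => //; rewrite /D /= in_itv/= andbT -ltrBrDl.
  rewrite -[ltRHS]invrK ltf_pV2 ?posrE ?invr_gt0 ?subr_gt0//.
  by rewrite (lt_trans xk)// ltr_nat.
have cv (m : {measure set mR -> \bar R}) : m (E `&` D n) @[n --> \oo] --> m E.
  rewrite {2}EE; apply: nondecreasing_cvg_mu.
  - by move=> n; apply: measurableI.
  - by rewrite -EE.
  - move=> i j ij; apply/subsetPset; apply: setIS => x.
    rewrite /D /= !in_itv/= !andbT; apply: le_lt_trans.
    by rewrite lerD2l lef_pV2 ?posrE// ler_nat.
transitivity (lim (m1 (E `&` D n) @[n --> \oo])).
  by apply/esym/cvg_lim => //; exact: cv.
have -> : (fun n => m1 (E `&` D n)) = (fun n => m2 (E `&` D n)).
  by apply/funext => n; exact: key.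
by apply/cvg_lim => //; exact: cv.
Qed.

Lemma measurable_cosecant (d : R) : measurable_fun [set: R] (fun v => d / sin v).
Proof.
apply: measurable_funM => //.
apply: (measurableT_comp (@measurable_invr R)); exact: measurable_sin.
Qed.

Lemma is_derive_cosecant (d v : R) : sin v != 0 ->
  is_derive v 1 (fun v => d / sin v) (- (d * cos v / sin v ^+ 2)).
Proof.
move=> s0.
have -> : (fun v => d / sin v) = (fun v => d *: (sin v)^-1) by [].
apply: is_derive_eq.
by rewrite /GRing.scale/=; field.
Qed.

Lemma cosecant_decreasing (d x y : R) : 0 < d -> 0 < x -> x < y -> y <= pi / 2 ->
  d / sin y < d / sin x.
Proof.
move=> d0 x0 xy y2; have pi0 := pi_gt0 R.
have sx : 0 < sin x by apply: sin_gt0_pi; lra.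
have sxy : sin x < sin y by rewrite ltr_sin ?in_itv/=; lra.
by rewrite ltr_pM2l// ltf_pV2// posrE; lra.
Qed.

Definition cosecant_density (d l : R) : R := d / (l * Num.sqrt (l ^+ 2 - d ^+ 2)).

Lemma continuous_cosecant_density (d l : R) (q : R -> R) : 0 < d -> d < l ->
  {for l, continuous q} ->
  {for l, continuous (fun l => q l * cosecant_density d l)}.
Proof.
move=> d0 dl cq; apply: cvgM; first exact: cq.
apply: cvgM; first exact: cvg_cst.
have r0 : 0 < l ^+ 2 - d ^+ 2 by rewrite subr_gt0 ltr_pXn2r// nnegrE; lra.
apply: cvgV; first by rewrite mulf_neq0 ?gt_eqF ?sqrtr_gt0//; lra.
apply: cvgM => //.
apply: (@cvg_comp _ _ _ (fun l : R => l ^+ 2 - d ^+ 2) (@Num.sqrt R) _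
          (nbhs (l ^+ 2 - d ^+ 2))); last exact: sqrt_continuous.
by apply: cvgB; [exact: exprn_continuous|exact: cvg_cst].
Qed.

(** The angle [asin (d / l)] at which two parallels at distance [d] are cut
    along a length [l] has derivative [- d / (l * sqrt (l ^+ 2 - d ^+ 2))]. *)
Lemma cosecant_substitution_itv (d x y : R) (q : R -> R) : 0 < d -> d < x -> x < y ->
  (forall l, d < l -> {for l, continuous q}) ->
  (\int[mu]_(l in `[x, y]) (q l * cosecant_density d l)%:E =
   \int[mu]_(v in `[asin (d / y)%R, asin (d / x)%R]) (q (d / sin v))%:E)%E.
Proof.
move=> d0 dx xy cq; have pi0 := pi_gt0 R.
have dI z : x <= z -> 0 < d / z < 1.
  by move=> xz; rewrite divr_gt0 ?ltr_pdivrMr /=; lra.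
have asinI z : x <= z -> sin (asin (d / z)) = d / z /\ 0 < asin (d / z) < pi / 2.
  move=> xz; have dzI := dI z xz; split; first by rewrite asinK// in_itv/=; lra.
  rewrite asin_ltpi2 ?andbT; last lra.
  rewrite -(sin_lt_asin_pihalf (t := d / z)) ?sin0; lra.
have [sx ax] := asinI x (lexx x); have [sy ay] := asinI y (ltW xy).
set a := asin (d / y) in sy ay *; set b := asin (d / x) in sx ax *.
have ab : a < b.
  rewrite -(sin_lt_asin_pihalf (t := d / x)) ?sy; [|by have := dI x (lexx x); lra|lra].
  by rewrite ltr_pM2l// ltf_pV2// posrE; lra.
have s0 v : v \in `[a, b] -> 0 < sin v.
  by rewrite in_itv/= => vI; apply: sin_gt0_pi; lra.
pose F v : R := d / sin v.
have Fa : F a = y by rewrite /F sy; field; rewrite !gt_eqF//; lra.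
have Fb : F b = x by rewrite /F sx; field; rewrite !gt_eqF//; lra.
have dF v : v \in `[a, b] -> derivable F v 1.
  by move=> /s0 sv; have [] := @is_derive_cosecant d v (lt0r_neq0 sv).
have dFE v : v \in `[a, b] -> derive1 F v = - (d * cos v / sin v ^+ 2).
  by move=> /s0 sv; rewrite derive1E; have [_ ->] := @is_derive_cosecant d v (lt0r_neq0 sv).
have cF v : v \in `[a, b] -> {for v, continuous F}.
  by move=> /dF dv; apply: differentiable_continuous; exact/derivable1_diffP.
have sub : `]a, b[ `<=` `[a, b] by apply: subset_itv_oo_cc.
have cF' v : v \in `[a, b] -> {for v, continuous (fun v => - (d * cos v / sin v ^+ 2))}.
  move=> /s0 sv; apply: cvgN; apply: cvgM.
    by apply: cvgM; [exact: cvg_cst|exact: continuous_cos].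
  apply: cvgV; first by rewrite expf_neq0 ?gt_eqF.
  by apply: (@continuous_comp _ _ _ sin (fun s => s ^+ 2)); [exact: continuous_sin|
    exact: exprn_continuous].
have ain : a \in `[a, b] by rewrite in_itv/= lexx ltW.
have bin : b \in `[a, b] by rewrite in_itv/= lexx ltW.
have cvgF' v : v \in `[a, b] -> derive1 F z @[z --> v] --> - (d * cos v / sin v ^+ 2).
  move=> vI; apply: cvg_trans (cF' v vI); apply: near_eq_cvg.
  have sn : \forall z \near v, 0 < sin z.
    exact: (cvgr_gt (sin v) (@continuous_sin R v) 0 (s0 v vI)).
  near=> z; have sz : 0 < sin z by near: z.
  by rewrite derive1E; have [_ ->] := @is_derive_cosecant d z (lt0r_neq0 sz).
rewrite -{1}Fa -{1}Fb (@integration_by_substitution_decreasing _ F _ a b).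
- apply: eq_integral => v; rewrite inE /= => vI; rewrite /cosecant_density /= !fctE dFE// opprK.
  have sv := s0 v vI.
  have cv : 0 < cos v by apply: cos_gt0_pihalf; move: vI; rewrite in_itv/=; lra.
  have -> : F v ^+ 2 - d ^+ 2 = (d * cos v / sin v) ^+ 2.
    rewrite /F; transitivity (d ^+ 2 * (1 - sin v ^+ 2) / sin v ^+ 2).
      by field; rewrite gt_eqF.
    by rewrite -cos2sin2; field; rewrite gt_eqF.
  rewrite sqrtr_sqr gtr0_norm; last by rewrite divr_gt0// mulr_gt0.
  by congr EFin; rewrite /F; field; rewrite !gt_eqF.
- exact: ltW.
- move=> u v; rewrite !in_itv/= => uI vI uv; rewrite /F cosecant_decreasing//; lra.
- by move=> v vI; rewrite /continuous_at dFE; [exact/cvgF'/sub|exact: sub].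
- by apply/cvg_ex; eexists; apply: cvg_at_right_filter; exact: cvgF' ain.
- by apply/cvg_ex; eexists; apply: cvg_at_left_filter; exact: cvgF' bin.
- split.
  + by move=> v /sub; exact: dF.
  + by apply: cvg_at_right_filter; exact: cF.
  + by apply: cvg_at_left_filter; exact: cF.
- rewrite Fa Fb; apply: continuous_in_subspaceT => l; rewrite inE/= in_itv/= => /andP[xl _].
  by apply: continuous_cosecant_density => //; [lra|apply: cq; lra].
Unshelve. all: by end_near.
Qed.

Lemma cosecant_itv (d x y v : R) : 0 < d -> d < x -> x < y -> 0 < v < pi / 2 ->
  (x < d / sin v <= y) = (asin (d / y) <= v < asin (d / x)).
Proof.
move=> d0 dx xy vI; have pi0 := pi_gt0 R.
have sv : 0 < sin v by apply: sin_gt0_pi; lra.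
have dI z : x <= z -> 0 <= d / z <= 1.
  by move=> xz; rewrite divr_ge0 ?ler_pdivrMr /=; lra.
have dyI := dI y (ltW xy); have dxI := dI x (lexx x).
rewrite -sin_lt_asin_pihalf//; last lra.
rewrite [asin _ <= _]leNgt -sin_lt_asin_pihalf//; last lra.
rewrite -leNgt andbC; congr (_ && _).
  by rewrite ler_pdivrMr// ler_pdivrMr ?[sin v * y]mulrC//; lra.
by rewrite ltr_pdivlMr// ltr_pdivlMr ?[sin v * x]mulrC//; lra.
Qed.

Lemma cosecant_gt (d v : R) : 0 < d -> 0 < v < pi / 2 -> d < d / sin v.
Proof.
move=> d0 vI; have pi0 := pi_gt0 R.
have sv : 0 < sin v by apply: sin_gt0_pi; lra.
rewrite ltr_pdivlMr// -[ltRHS]mulr1 ltr_pM2l// -(@sin_pihalf R) ltr_sin ?in_itv/=; lra.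
Qed.

Lemma cosecant_substitution (d : R) (q : R -> R) (E : set R) : 0 < d ->
  (forall l, d < l -> {for l, continuous q}) -> (forall l, d < l -> 0 <= q l) ->
  measurable E ->
  (\int[mu]_(v in (fun v => (d / sin v)%R) @^-1` E `&` `]0%R, (pi / 2)%R[)
      (q (d / sin v))%:E =
   \int[mu]_(l in E `&` `]d, +oo[) (q l * cosecant_density d l)%:E)%E.
Proof.
move=> d0 cq q0 mE; have pi0 := pi_gt0 R.
have mI : measurable (`]0, (pi / 2)[%classic : set R) by exact: measurable_itv.
have mJ : measurable (`]d, +oo[%classic : set R) by exact: measurable_itv.
pose F1 := (fun v : R => (q (d / sin v))%:E) \_ `]0, (pi / 2)[.
pose F2 := (fun l : R => (q l * cosecant_density d l)%:E) \_ `]d, +oo[.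
have mq1 : measurable_fun (`]0, (pi / 2)[%classic : set R) (fun v : R => (q (d / sin v))%:E).
  apply/measurable_EFinP.
  apply: open_continuous_measurable_fun; first exact: interval_open.
  move=> v; rewrite inE/= in_itv/= => vI.
  have sv : 0 < sin v by apply: sin_gt0_pi; lra.
  have cv : {for v, continuous (fun v => d / sin v)}.
    apply: differentiable_continuous; apply/derivable1_diffP.
    by have [] := @is_derive_cosecant d v (lt0r_neq0 sv).
  apply: (continuous_comp cv); apply: cq; exact: cosecant_gt.
have F10 v : (0 <= F1 v)%E.
  apply: erestrict_ge0 => {}v; rewrite /= in_itv/= => vI.
  by rewrite lee_fin q0// cosecant_gt.
have mF1 : measurable_fun [set: R] F1.
  exact: (iffLR (measurable_restrictT (fun v : R => (q (d / sin v))%:E) mI)).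
have mq2 : measurable_fun (`]d, +oo[%classic : set R)
    (fun l : R => (q l * cosecant_density d l)%:E).
  apply/measurable_EFinP.
  apply: open_continuous_measurable_fun; first exact: interval_open.
  move=> l; rewrite inE/= in_itv/= andbT => dl.
  by apply: continuous_cosecant_density => //; exact: cq.
have mF2 : measurable_fun [set: R] F2.
  exact: (iffLR (measurable_restrictT (fun l : R => (q l * cosecant_density d l)%:E) mJ)).
have F20 l : (0 <= F2 l)%E.
  apply: erestrict_ge0 => {}l; rewrite /= in_itv/= andbT => dl.
  rewrite lee_fin mulr_ge0 ?q0// /cosecant_density divr_ge0 ?mulr_ge0 ?sqrtr_ge0//; lra.
have [n1 n1E] := density_measure mF1 F10.
have [m2 m2E] := density_measure mF2 F20.
pose m1' : {measure set mR -> \bar R} := pushforward n1 (fun v : mR => d / sin v : mR).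
pose m1 := m1' (measurable_cosecant d).
have m1E A : m1 A = (\int[mu]_(v in (fun v => (d / sin v)%R) @^-1` A `&` `]0%R, (pi / 2)%R[)
      (q (d / sin v))%:E)%E.
  by rewrite integral_mkcondr -n1E.
have {}m2E A : m2 A = (\int[mu]_(l in A `&` `]d, +oo[) (q l * cosecant_density d l)%:E)%E.
  by rewrite integral_mkcondr -m2E.
have m2_itv (x y : R) : d < x -> m2 `]x, y]%classic =
    (\int[mu]_(l in `[x, y]) (q l * cosecant_density d l)%:E)%E.
  move=> dx; have sub : `]x, y] `<=` `]d, +oo[.
    by move=> z /=; rewrite !in_itv/=; lra.
  rewrite m2E setIidl// integral_itv_obnd_cbnd//.
  exact: measurable_funS mq2.
have m1_itv (x y : R) : d < x -> x < y -> m1 `]x, y]%classic =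
    (\int[mu]_(v in `[asin (d / y)%R, asin (d / x)%R]) (q (d / sin v))%:E)%E.
  move=> dx xy; have dI z : x <= z -> 0 < d / z < 1.
    by move=> xz; rewrite divr_gt0 ?ltr_pdivrMr /=; lra.
  have a0 : 0 < asin (d / y).
    have := dI y (ltW xy) => ?.
    by rewrite -(sin_lt_asin_pihalf (t := d / y)) ?sin0; lra.
  have b2 : asin (d / x) < pi / 2.
    by have := dI x (lexx x) => ?; apply: asin_ltpi2; lra.
  have sub : `[asin (d / y), asin (d / x)[ `<=` `]0, (pi / 2)[.
    by move=> z /=; rewrite !in_itv/=; lra.
  rewrite m1E [X in integral _ X _](_ : _ = `[asin (d / y), asin (d / x)[%classic).
    by rewrite integral_itv_bndo_bndc//; exact: measurable_funS mq1.
  apply/seteqP; split => v.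
    move=> [/=]; rewrite !in_itv/= => vxy vI.
    by rewrite -cosecant_itv.
  move=> vab; have := sub _ vab; rewrite /= !in_itv/= => vI; split => //.
  by move: vab; rewrite /= in_itv/= -cosecant_itv.
have m12 (x y : R) : d < x -> x < y -> m1 `]x, y]%classic = m2 `]x, y]%classic.
  by move=> dx xy; rewrite m1_itv// m2_itv// (cosecant_substitution_itv d0 dx xy cq).
have fin (x y : R) : d < x -> x < y -> (m1 `]x, y]%classic < +oo)%E.
  move=> dx xy; rewrite m12// m2_itv//.
  have : mu.-integrable `[x, y] (EFin \o (fun l => q l * cosecant_density d l)).
    apply: continuous_compact_integrable; first exact: segment_compact.
    apply: continuous_in_subspaceT => l; rewrite inE/= in_itv/= => /andP[xl _].
    by apply: continuous_cosecant_density => //; [lra|apply: cq; lra].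
  by move/integrable_fin_num => /(_ (measurable_itv _)); rewrite ltey_eq => ->.
transitivity (m1 (E `&` `]d, +oo[)).
  rewrite m1E; congr (integral _ _ _); apply/seteqP; split => v [/=] vE vI; split => //.
    split=> //; move: vI; rewrite !in_itv/= andbT; exact: cosecant_gt.
  by case: vE.
rewrite (eq_measure_open_ray m12 fin)//.
- by rewrite m2E -setIA setIid.
- exact: measurableI.
Qed.

End Cosecant.

(** * Two parallel segments *)

Section Strip.
Variable R : realType.
Notation mu := (@lebesgue_measure R).

Variables (u : plane R) (h0 h1 x1 x2 y1 y2 : R).
Hypotheses (uu : dot u u = 1) (x12 : x1 < x2) (y12 : y1 < y2) (h01 : h0 != h1).

Let foot (h : R) : plane R := (- (h * u.2), h * u.1).
Let S := (ray_pt (foot h0) u x1, ray_pt (foot h0) u x2).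
Let T := (ray_pt (foot h1) u y1, ray_pt (foot h1) u y2).
Let delta := h1 - h0.
Let d := `|delta|.

Let d0 : 0 < d. Proof. by rewrite normr_gt0 subr_eq0 eq_sym. Qed.

(** The overlap of the first segment with the second one slid by [s] along their
    common direction. *)
Let overlap (s : R) : R :=
  pospart (Num.min (y2 + s) x2 - Num.max (y1 + s) x1).

Let overlap_ge0 s : 0 <= overlap s.
Proof. by rewrite /overlap /pospart le_max lexx orbT. Qed.

Let continuous_overlap : continuous overlap.
Proof.
move=> s; apply: cvg_maxr; last exact: cvg_cst.
apply: cvgB.
  by apply: cvg_minr; [apply: cvgD => //; exact: cvg_cst|exact: cvg_cst].
by apply: cvg_maxr; [apply: cvgD => //; exact: cvg_cst|exact: cvg_cst].
Qed.

Let measurable_overlap : measurable_fun [set: R] overlap.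
Proof. by apply: continuous_measurable_fun; exact: continuous_overlap. Qed.

Let ht_foot th h : ht th (foot h) = h * tc th u.
Proof. by rewrite /ht /tc /foot /=; ring. Qed.

Let tc_foot th h : tc th (foot h) = - (h * ht th u).
Proof. by rewrite /ht /tc /foot /=; ring. Qed.

Let ht_tc_sqr th : ht th u ^+ 2 + tc th u ^+ 2 = 1.
Proof.
transitivity (dot u u * (cos th ^+ 2 + sin th ^+ 2)).
  by rewrite /ht /tc /dot; ring.
by rewrite uu cos2Dsin2 mulr1.
Qed.

(** In a fixed direction all chords between the two parallels have the same
    length. *)
Lemma cut_lines_strip th (E : set R) : E `<=` `]0, +oo[ ->
  let s := ht th u in let c := tc th u in
  measurable (cut_lines th S T E) /\
  (mu (cut_lines th S T E) =
   (\1_E (d / `|s|) * (`|s| * overlap (delta * (c / s))))%:E)%E.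
Proof.
move=> E0 s c.
have [s0|s0] := eqVneq s 0.
  have -> : cut_lines th S T E = set0.
    by apply/seteqP; split => p //= -[] /(crosses_ray _ _ _ _ x12) [] /eqP.
  by rewrite s0 normr0 mul0r mulr0 measure0.
have lenE p : `|cross_t th p S - cross_t th p T| = d / `|s|.
  rewrite !cross_t_ray//; rewrite !ht_foot !tc_foot -/s -/c -normf_div; congr `|_|.
  transitivity (delta * (s ^+ 2 + c ^+ 2) / s); first by rewrite /delta; field.
  by rewrite ht_tc_sqr mulr1.
rewrite indicE; have [ldE|ldE] := pselect (E (d / `|s|)); last first.
  rewrite memNset// mul0r; suff -> : cut_lines th S T E = set0 by rewrite measure0.
  by apply/seteqP; split => p //= -[_ _]; rewrite lenE.
rewrite mem_set// mul1r; set sg := delta * (c / s).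
set lo := Num.max (y1 + sg) x1; set hi := Num.min (y2 + sg) x2.
have cutE : cut_lines th S T E =
    (fun p => s^-1 * p + - (h0 * c / s)) @^-1` `]lo, hi[.
  apply/seteqP; split => p.
    move=> [/(crosses_ray _ _ _ _ x12) [_]]; rewrite ht_foot -/s -/c => zS.
    move=> /(crosses_ray _ _ _ _ y12) [_]; rewrite ht_foot -/s -/c => zT _.
    rewrite /= in_itv/= gt_max lt_min.
    have E1 : s^-1 * p + - (h0 * c / s) = (p - h0 * c) / s by field.
    have E2 : (p - h1 * c) / s = (p - h0 * c) / s - sg by rewrite /sg /delta; field.
    by rewrite E1; rewrite E2 in zT; lra.
  rewrite /= in_itv/= gt_max lt_min.
  have -> : s^-1 * p + - (h0 * c / s) = (p - h0 * c) / s by field.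
  have E2 : (p - h1 * c) / s = (p - h0 * c) / s - sg by rewrite /sg /delta; field.
  move=> H; split; [apply/crosses_ray => //|apply/crosses_ray => //|by rewrite lenE].
    by rewrite ht_foot -/s -/c; split => //; lra.
  by rewrite ht_foot -/s -/c; split => //; rewrite E2; lra.
rewrite cutE; split.
  rewrite -[X in measurable X]setTI.
  by apply: (measurable_funD (measurable_funM _ _) _) => //; exact: measurable_itv.
rewrite lebesgue_measure_affine ?invr_eq0// normfV invrK EFinM; congr (_ * _)%E.
rewrite lebesgue_measure_itv/= lte_fin /overlap /pospart -/lo -/hi.
case: ltP => lohi; first by rewrite -EFinB max_l// subr_ge0 ltW.
by rewrite max_r// subr_le0.
Qed.

Let strip_fun (E : set R) (v : R) : R :=
  \1_E (d / `|sin v|) * (`|sin v| * overlap (- delta * (cos v / sin v))).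

Let measurable_strip_fun (E : set R) : measurable E -> measurable_fun [set: R] (strip_fun E).
Proof.
move=> mE; have mns : measurable_fun [set: R] (fun v : R => `|sin v|).
  exact: measurableT_comp (@normr_measurable R setT) (@measurable_sin R).
apply: measurable_funM.
  have mi : measurable_fun [set: R] (\1_E : R -> R) by exact: measurable_indic.
  apply: (measurableT_comp mi).
  by apply: measurable_funM => //; apply: (measurableT_comp (@measurable_invr R)).
apply: measurable_funM => //; apply: (measurableT_comp measurable_overlap).
apply: measurable_funM => //; apply: measurable_funM; first exact: measurable_cos.
apply: (measurableT_comp (@measurable_invr R)); exact: measurable_sin.
Qed.

Let strip_fun_ge0 E v : 0 <= strip_fun E v.
Proof. by rewrite mulr_ge0 ?mulr_ge0// indicE. Qed.

Lemma strip_rotation : exists2 phi, 0 <= phi <= pi &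
  forall E th, \1_E (d / `|ht th u|) * (`|ht th u| * overlap (delta * (tc th u / ht th u)))
    = strip_fun E (th - phi).
Proof.
have [phi [eta [phiI eta2 e1 e2]]] := unit_angle uu.
exists phi => // E th; rewrite /strip_fun.
have sE : ht th u = - eta * sin (th - phi) by rewrite /ht e1 e2 sinB; ring.
have cE : tc th u = eta * cos (th - phi) by rewrite /tc e1 e2 cosB; ring.
have eta1 : `|- eta| = 1.
  by apply/eqP; rewrite -(eqrXn2 (n := 2))// -normrX sqrrN eta2 expr1n normr1.
have etaV : (- eta)^-1 = - eta.
  have e0 : - eta != 0 by rewrite -normr_eq0 eta1 oner_neq0.
  by apply: (mulfI e0); rewrite mulfV// -expr2 sqrrN.
have -> : `|ht th u| = `|sin (th - phi)| by rewrite sE normrM eta1 mul1r.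
congr (_ * (_ * overlap _)); rewrite sE cE invfM etaV.
transitivity (- delta * eta ^+ 2 * (cos (th - phi) / sin (th - phi))); first by ring.
by rewrite eta2 mulr1.
Qed.

(** [d / l] is the sine of the angle between a chord of length [l] and the two
    parallels, and [sqrt (l ^+ 2 - d ^+ 2)] the projection of the chord on them. *)
Let strip_weight (l : R) : R :=
  let r := Num.sqrt (l ^+ 2 - d ^+ 2) in d / l * (overlap (- r) + overlap r).

(** The angles [v] and [pi - v] give the same length and opposite slides, hence the
    two terms of the formula. *)
Lemma strip_fold (E : set R) (v : R) : 0 < v < pi / 2 ->
  strip_fun E v + strip_fun E (pi - v) = \1_E (d / sin v) * strip_weight (d / sin v).
Proof.
move=> vI; have pi0 := pi_gt0 R.
have sv : 0 < sin v by apply: sin_gt0_pi; lra.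
have cv : 0 < cos v by apply: cos_gt0_pihalf; lra.
rewrite /strip_fun sin_pisub cos_pisub gtr0_norm// -!mulrDr; congr (_ * _).
rewrite /strip_weight; have -> : d / (d / sin v) = sin v by field; rewrite !gt_eqF.
congr (_ * _).
have -> : Num.sqrt ((d / sin v) ^+ 2 - d ^+ 2) = d * (cos v / sin v).
  have -> : (d / sin v) ^+ 2 - d ^+ 2 = (d * (cos v / sin v)) ^+ 2.
    rewrite !expr_div_n exprMn expr_div_n cos2sin2; field; by rewrite gt_eqF.
  by rewrite sqrtr_sqr gtr0_norm// mulr_gt0// divr_gt0.
have -> : - delta * (- cos v / sin v) = delta * (cos v / sin v) by ring.
rewrite mulNr /d; have [dp|dn] := leP 0 delta; first by rewrite ger0_norm.
by rewrite ltr0_norm// mulNr opprK addrC.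
Qed.

Lemma continuous_strip_weight (l : R) : d < l -> {for l, continuous strip_weight}.
Proof.
move=> dl; apply: cvgM.
  apply: cvgM; first exact: cvg_cst.
  by apply: cvgV => //; rewrite gt_eqF// (lt_trans d0).
have cr : {for l, continuous (fun l : R => Num.sqrt (l ^+ 2 - d ^+ 2))}.
  apply: (@cvg_comp _ _ _ (fun l : R => l ^+ 2 - d ^+ 2) (@Num.sqrt R) _
            (nbhs (l ^+ 2 - d ^+ 2))); last exact: sqrt_continuous.
  by apply: cvgB; [exact: exprn_continuous|exact: cvg_cst].
apply: cvgD.
  apply: (@cvg_comp _ _ _ (fun l : R => - Num.sqrt (l ^+ 2 - d ^+ 2)) overlap _
            (nbhs (- Num.sqrt (l ^+ 2 - d ^+ 2)))); last exact: continuous_overlap.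
  exact: cvgN.
by apply: (@cvg_comp _ _ _ (fun l : R => Num.sqrt (l ^+ 2 - d ^+ 2)) overlap _
  (nbhs (Num.sqrt (l ^+ 2 - d ^+ 2)))); last exact: continuous_overlap.
Qed.

Lemma strip_weight_ge0 (l : R) : d < l -> 0 <= strip_weight l.
Proof.
move=> dl; rewrite mulr_ge0 ?addr_ge0// divr_ge0 ?ltW//.
by rewrite (lt_trans d0).
Qed.

Lemma integral_strip (E : set R) : measurable E ->
  (\int[mu]_(v in `[0%R, pi[) (strip_fun E v)%:E =
   \int[mu]_(l in E `&` `]d, +oo[) (strip_weight l * cosecant_density d l)%:E)%E.
Proof.
move=> mE; have pi0 := pi_gt0 R.
have mK (D : set R) : measurable_fun D (fun v => (strip_fun E v)%:E).
  by apply/measurable_EFinP/measurable_funTS; exact: measurable_strip_fun.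
have K0 v : (0 <= (strip_fun E v)%:E)%E by rewrite lee_fin.
have -> : `[0, pi[%classic = `[0, (pi / 2)[%classic `|` `[(pi / 2), pi[%classic :> set R.
  apply/seteqP; split => v /=; rewrite !in_itv/=.
    by move=> vI; have [?|?] := ltP v (pi / 2); [left|right]; lra.
  by case; lra.
rewrite ge0_integral_setU//=; first last.
- by apply/disj_setPS => v [] /=; rewrite !in_itv/=; lra.
- exact: mK.
rewrite -[X in (_ + X)%E](@ge0_integral_reflection _ pi)//; last exact: mK.
rewrite [X in (_ + integral _ X _)%E](_ : _ = `]0, (pi / 2)]%classic); last first.
  by apply/seteqP; split => v /=; rewrite !in_itv/=; lra.
have mK' : measurable_fun (`]0, (pi / 2)[%classic : set R)
    (fun v => (strip_fun E (pi - v))%:E).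
  apply/measurable_EFinP; apply: measurable_funTS.
  by apply: (measurableT_comp (measurable_strip_fun mE)); exact: measurable_funB.
rewrite [X in (X + _)%E]integral_itv_bndoo; last exact: mK.
rewrite [X in (_ + X)%E]integral_itv_bndoo; last exact: mK'.
rewrite -ge0_integralD//; last exact: mK.
rewrite -(cosecant_substitution d0 continuous_strip_weight strip_weight_ge0 mE).
rewrite integral_mkcondl; apply: eq_integral => v; rewrite inE/= in_itv/= => vI.
rewrite -EFinD strip_fold// patchE indicE.
have [vE|vE] := boolP (v \in _).
  by rewrite mem_set ?mul1r//; move: vE; rewrite inE.
by rewrite memNset ?mul0r// => H; move/negP: vE; apply; rewrite inE.
Qed.

Definition rho_strip (l : R) : R :=
  let r := Num.sqrt (l ^+ 2 - d ^+ 2) in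
  if l <= d then 0 else
  d ^+ 2 / (l ^+ 2 * r) *
  (pospart (Num.min (y2 - r) x2 - Num.max (y1 - r) x1)
   + pospart (Num.min (y2 + r) x2 - Num.max (y1 + r) x1)).

Lemma rho_stripE : rho_strip =
  (fun l => strip_weight l * cosecant_density d l) \_ `]d, +oo[.
Proof.
apply/funext => l; rewrite patchE /rho_strip mem_setE in_itv/= andbT ltNge.
case: leP => //= dl; have l0 : 0 < l := lt_trans d0 dl.
rewrite /strip_weight /cosecant_density /overlap; field.
by rewrite !gt_eqF ?sqrtr_gt0 ?subr_gt0 ?ltrXn2r// ltW.
Qed.

Lemma pair_density_strip : pair_density S T rho_strip.
Proof.
have mq : measurable_fun (`]d, +oo[%classic : set R)
    (fun l => strip_weight l * cosecant_density d l).
  apply: open_continuous_measurable_fun; first exact: interval_open.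
  move=> l; rewrite inE/= in_itv/= andbT => dl.
  by apply: continuous_cosecant_density => //; exact: continuous_strip_weight.
exists rho_strip, set0; split.
- rewrite rho_stripE; apply: (iffLR (measurable_restrictT _ _)) => //.
- move=> l; rewrite rho_stripE; apply: restrict_ge0 => {}l.
  rewrite /= in_itv/= andbT => dl; rewrite mulr_ge0 ?strip_weight_ge0//.
  by rewrite divr_ge0 ?mulr_ge0 ?sqrtr_ge0// ltW// (lt_trans d0).
- exact: finite_set0.
- by [].
- move=> E mE E0; have [phi phiI strE] := strip_rotation.
  have HE th : mu (cut_lines th S T E) = (strip_fun E (th - phi))%:E.
    by rewrite (cut_lines_strip th E0).2 strE.
  split; first by move=> th; have [] := cut_lines_strip th E0.
    rewrite (_ : (fun th => _) = (fun th => (strip_fun E (th - phi))%:E)).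
      apply/measurable_EFinP.
      apply: (measurableT_comp (measurable_strip_fun mE)); exact: measurable_funB.
    by apply/funext.
  under eq_integral do rewrite HE.
  rewrite (@ge0_integral_periodic _ pi phi (fun v => (strip_fun E v)%:E))//; first last.
  + by move=> v; rewrite /strip_fun sinDpi cosDpi normrN invrN mulrNN.
  + by move=> v; rewrite lee_fin.
  + by apply/measurable_EFinP; exact: measurable_strip_fun.
  rewrite integral_strip// integral_mkcondr; apply: eq_integral => l _.
  by rewrite rho_stripE !patchE; case: ifP.
Qed.

End Strip.

Section Parallel.
Variable R : realType.
Implicit Types (S T : plane R * plane R).

Lemma unit_coordinates (u P : plane R) : dot u u = 1 ->
  P = ray_pt (- (det2 u P * u.2), det2 u P * u.1) u (dot P u).
Proof.
move=> uu; rewrite {1}[P]surjective_pairing /ray_pt /=; congr (_, _).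
  transitivity (dot u u * P.1); first by rewrite uu mul1r.
  by rewrite /dot /det2; ring.
transitivity (dot u u * P.2); first by rewrite uu mul1r.
by rewrite /dot /det2; ring.
Qed.

Lemma pair_density_parallel S T : sides_N S T = 0 ->
  S.1 != S.2 -> T.1 != T.2 -> det2 (vec S.1 S.2) (vec S.1 T.1) != 0 ->
  pair_density S T (rho_pair S T).
Proof.
move=> N0 S12 T12 ST; pose V := vec S.1 S.2.
have V0 : V != (0, 0).
  apply: contraNneq ST => V0; rewrite -/V V0 /det2 /=.
  by rewrite !mul0r subrr.
have e0 := enorm_gt0 V0.
set e := enorm V in e0.
pose u : plane R := (V.1 / e, V.2 / e).
have uu : dot u u = 1.
  transitivity (dot V V / e ^+ 2); first by rewrite /dot /=; field; rewrite gt_eqF.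
  by rewrite -enorm_sqr divff// expf_neq0// gt_eqF.
have xSE P : dot P V / e = dot P u by rewrite /dot /=; field; rewrite gt_eqF.
have hS : det2 u S.2 = det2 u S.1.
  by rewrite /det2 /u /V /vec /=; field; rewrite gt_eqF.
have hT : det2 u T.2 = det2 u T.1.
  apply/eqP; rewrite -subr_eq0; apply/eqP.
  transitivity (sides_N S T / e); last by rewrite N0 mul0r.
  by rewrite /sides_N -/V /u /det2 /vec /=; field; rewrite gt_eqF.
have hST : det2 u T.1 - det2 u S.1 = det2 V (vec S.1 T.1) / e.
  by rewrite /u /V /det2 /vec /=; field; rewrite gt_eqF.
have h01 : det2 u S.1 != det2 u T.1.
  by rewrite eq_sym -subr_eq0 hST mulf_neq0// invr_eq0 gt_eqF.
have xS12 : dot S.1 u < dot S.2 u.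
  rewrite -subr_gt0 (_ : _ - _ = dot V V / e); last first.
    by rewrite /dot /u /V /vec /=; field; rewrite gt_eqF.
  by rewrite -enorm_sqr divr_gt0// exprn_gt0.
have S1E := unit_coordinates S.1 uu.
have S2E := unit_coordinates S.2 uu; rewrite hS in S2E.
have T1E := unit_coordinates T.1 uu.
have T2E := unit_coordinates T.2 uu; rewrite hT in T2E.
have dE : `|det2 V (vec S.1 T.1)| / e = `|det2 u T.1 - det2 u S.1|.
  by rewrite hST normrM normfV (gtr0_norm e0).
have rhoE' y1 y2 l : y1 = Num.min (dot T.1 u) (dot T.2 u) ->
    y2 = Num.max (dot T.1 u) (dot T.2 u) ->
    rho_strip (det2 u S.1) (det2 u T.1) (dot S.1 u) (dot S.2 u) y1 y2 l = rho_pair S T l.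
  move=> -> ->; rewrite /rho_pair N0 eqxx /rho_parallel /rho_strip -/V -/e dE !xSE.
  by rewrite (min_l (ltW xS12)) (max_r (ltW xS12)).
have [xT|xT|xT] := ltgtP (dot T.1 u) (dot T.2 u).
- apply: eq_pair_density (pair_density_strip uu xS12 xT h01).
    by move=> th E; rewrite -S1E -S2E -T1E -T2E -!surjective_pairing.
  by move=> l; apply: rhoE'; rewrite ?(min_l (ltW xT)) ?(max_r (ltW xT)).
- apply: eq_pair_density (pair_density_strip uu xS12 xT h01).
    move=> th E; rewrite -S1E -S2E -T1E -T2E -surjective_pairing.
    by rewrite cut_linesC cut_lines_flipl cut_linesC.
  by move=> l; apply: rhoE'; rewrite ?(min_r (ltW xT)) ?(max_l (ltW xT)).
by case/eqP: T12; rewrite T1E T2E xT.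
Qed.

End Parallel.

(** * Chords of a convex polygon *)

Section ConvexPolygon.
Variables (R : realType) (n : nat) (v : 'I_n -> plane R).
Implicit Types (i j k : 'I_n) (P Q : plane R) (th p t : R).

(** Cyclic induction on the vertices; it produces a side along which the boundary
    goes up, and one along which it goes down, through a given level. *)
Lemma ordS_closed (q : 'I_n -> bool) :
  (forall i, q i -> q (ordS i)) -> forall i j, q i -> q j.
Proof.
move=> qS i j qi.
have qiter m : q (iter m (@ordS n) i) by elim: m => //= m; exact: qS.
suff -> : j = iter (j + (n - i)) (@ordS n) i by [].
have valiter m : val (iter m (@ordS n) i) = ((i + m) %% n)%N.
  elim: m => [|m IH]; first by rewrite addn0 modn_small.
  by rewrite iterS /= IH -[in LHS]addn1 modnDml addn1 addnS.
apply/val_inj; rewrite valiter addnCA subnKC; last exact: ltnW.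
by rewrite modnDr modn_small.
Qed.

Lemma ordS_neq i : (1 < n)%N -> ordS i != i.
Proof.
move=> n1; apply/eqP => /(congr1 val) /=.
have := ltn_ord i; rewrite leq_eqVlt => /predU1P[iE|lt].
  by rewrite iE modnn => i0; move: iE n1; rewrite -i0 => <-.
by rewrite modn_small// => /eqP; rewrite eqn_leq ltnn.
Qed.

Lemma region_vertex k : region v (v k).
Proof.
exists (fun i => (i == k)%:R); split=> //.
- by rewrite (bigD1 k)//= eqxx big1 ?addr0// => i /negbTE ->.
- by rewrite (bigD1 k)//= eqxx mul1r big1 ?addr0// => i /negbTE ->; rewrite mul0r.
- by rewrite (bigD1 k)//= eqxx mul1r big1 ?addr0// => i /negbTE ->; rewrite mul0r.
Qed.

Lemma region_segment P Q (x : R) : region v P -> region v Q -> 0 <= x <= 1 ->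
  region v ((1 - x) * P.1 + x * Q.1, (1 - x) * P.2 + x * Q.2).
Proof.
move=> [w [w0 w1 P1 P2]] [z [z0 z1 Q1 Q2]] xI.
exists (fun i => (1 - x) * w i + x * z i); split => /=.
- by move=> i; rewrite addr_ge0// mulr_ge0//; lra.
- by rewrite big_split/= -!mulr_sumr w1 z1; ring.
- rewrite P1 Q1 !mulr_sumr -big_split/=; apply: eq_bigr => i _; ring.
- rewrite P2 Q2 !mulr_sumr -big_split/=; apply: eq_bigr => i _; ring.
Qed.

Lemma region_affine_ge0 (a b c : R) P :
  (forall k, 0 <= a + b * (v k).1 + c * (v k).2) -> region v P ->
  0 <= a + b * P.1 + c * P.2.
Proof.
move=> H [w [w0 w1 P1 P2]].
have -> : a + b * P.1 + c * P.2 = \sum_i w i * (a + b * (v i).1 + c * (v i).2).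
  have aE : a = \sum_i w i * a by rewrite -mulr_suml w1 mul1r.
  rewrite P1 P2 {1}aE !mulr_sumr -!big_split/=.
  by apply: eq_bigr => i _; ring.
by apply: sumr_ge0 => i _; rewrite mulr_ge0.
Qed.

Lemma side_ofE i P : let V := vec (v i) (v (ordS i)) in
  side_of v i P = (V.2 * (v i).1 - V.1 * (v i).2) + (- V.2) * P.1 + V.1 * P.2.
Proof. by rewrite /side_of /det2 /vec /=; ring. Qed.

Lemma side_of_fst i : side_of v i (v i) = 0.
Proof. by rewrite /side_of /det2 /vec /=; ring. Qed.

Lemma side_of_snd i : side_of v i (v (ordS i)) = 0.
Proof. by rewrite /side_of /det2 /vec /=; ring. Qed.

Hypotheses (n2 : (2 < n)%N) (ncol : no_collinear_sides v).

(** [sg i] records on which side of the [i]-th side the polygon lies. *)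
Variable sg : 'I_n -> R.
Hypothesis sg0 : forall i, sg i != 0.
Hypothesis sg_vertex : forall i k, 0 <= sg i * side_of v i (v k).

Definition half_planes P : Prop := forall i, 0 <= sg i * side_of v i P.

Lemma region_half_planes P : region v P -> half_planes P.
Proof.
move=> KP i; pose V := vec (v i) (v (ordS i)).
have E Q : sg i * side_of v i Q =
    sg i * (V.2 * (v i).1 - V.1 * (v i).2) + (- sg i * V.2) * Q.1 + (sg i * V.1) * Q.2.
  by rewrite side_ofE -/V; ring.
have H k : 0 <= sg i * (V.2 * (v i).1 - V.1 * (v i).2) + (- sg i * V.2) * (v k).1
    + (sg i * V.1) * (v k).2 by rewrite -E.
by rewrite E; exact: (region_affine_ge0 H KP).
Qed.

(** At a vertex where a linear form is maximal the two adjacent sides span a cone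
    on which the form stays below its value at the vertex. *)
Lemma half_planes_linear_le (b c : R) P : half_planes P ->
  exists k, b * P.1 + c * P.2 <= b * (v k).1 + c * (v k).2.
Proof.
move=> HP; pose f k := b * (v k).1 + c * (v k).2.
have i0 : 'I_n by exact: (Ordinal (ltn_trans (ltn0Sn 1) n2)).
have [k _ kmax] : exists2 k, true & forall i, f i <= f k.
  case: (@Order.TotalTheory.arg_maxP _ _ _ i0 predT f isT) => k _ km.
  by exists k => // i; exact: km.
exists k; pose j := ord_pred k.
have jk : ordS j = k by rewrite ord_predK.
have jNk : j != k by rewrite -[X in _ != X]jk eq_sym ordS_neq// ltnW.
have Sk : side_of v k (v j) != 0.
  apply/eqP => H; apply: (ncol (i := k) (j := j)); first by rewrite eq_sym.
  by split => //=; rewrite jk side_of_fst.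
have Sj : side_of v j (v (ordS k)) != 0.
  apply/eqP => H; apply: (ncol (i := j) (j := k)) => //.
  by split => //=; rewrite -[X in v X]jk side_of_snd.
pose x := side_of v k P / side_of v k (v j).
pose y := side_of v j P / side_of v j (v (ordS k)).
have quot_ge0 (s a d : R) : s != 0 -> 0 <= s * a -> 0 <= s * d -> 0 <= a / d.
  move=> s0 sa sd; rewrite -(mulKf s0 a) -(mulKf s0 d) invfM mulrACA.
  by rewrite mulfV ?invr_eq0// mul1r divr_ge0.
have x0 : 0 <= x by apply: (quot_ge0 (sg k)).
have y0 : 0 <= y by apply: (quot_ge0 (sg j)).
have dE : side_of v j (v (ordS k)) = side_of v k (v j).
  by rewrite /side_of /side /= jk /det2 /vec /=; ring.
have cone : side_of v k (v j) * (b * P.1 + c * P.2) = side_of v k (v j) * f k +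
    side_of v k P * (f j - f k) + side_of v j P * (f (ordS k) - f k).
  by rewrite /side_of /side /= jk /f /det2 /vec /=; ring.
have E : b * P.1 + c * P.2 = f k + x * (f j - f k) + y * (f (ordS k) - f k).
  by apply: (mulfI Sk); rewrite cone /x /y dE; field.
rewrite E -/(f k).
have := kmax j; have := kmax (ordS k) => k1 k2.
by have := mulr_ge0_le0 x0 (_ : f j - f k <= 0);
  have := mulr_ge0_le0 y0 (_ : f (ordS k) - f k <= 0); rewrite !subr_le0; lra.
Qed.

Lemma ht_vec th P Q : ht th (vec P Q) = ht th Q - ht th P.
Proof. by rewrite /ht /vec /=; ring. Qed.

Lemma tc_vec th P Q : tc th (vec P Q) = tc th Q - tc th P.
Proof. by rewrite /tc /vec /=; ring. Qed.

Lemma ht_line_pt th p t : ht th (line_pt (p, th) t) = p.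
Proof.
transitivity (p * (cos th ^+ 2 + sin th ^+ 2)); first by rewrite /ht /=; ring.
by rewrite cos2Dsin2 mulr1.
Qed.

Lemma tc_line_pt th p t : tc th (line_pt (p, th) t) = t.
Proof.
transitivity (t * (cos th ^+ 2 + sin th ^+ 2)); first by rewrite /tc /=; ring.
by rewrite cos2Dsin2 mulr1.
Qed.

Lemma line_pt_ht_tc th P : line_pt (ht th P, th) (tc th P) = P.
Proof.
rewrite [RHS]surjective_pairing /line_pt /ht /tc /=; congr (_, _).
  transitivity (P.1 * (cos th ^+ 2 + sin th ^+ 2)); first by ring.
  by rewrite cos2Dsin2 mulr1.
transitivity (P.2 * (cos th ^+ 2 + sin th ^+ 2)); first by ring.
by rewrite cos2Dsin2 mulr1.
Qed.

Section FixedLine.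
Variables (th p : R).
Let h k := ht th (v k).
Let T i := cross_t th p (side v i).
Let cr i := crosses th p (side v i).
Let pt t := line_pt (p, th) t.

Let cr_neq i : cr i -> h (ordS i) - h i != 0.
Proof. exact: crosses_ht_neq. Qed.

Lemma side_of_line_pt i t : cr i ->
  side_of v i (pt t) = (h (ordS i) - h i) * (T i - t).
Proof.
move=> /cr_neq d0; rewrite /side_of (det2_ht_tc th) !ht_vec !tc_vec.
rewrite ht_line_pt tc_line_pt /T /cross_t /side /= -/(h i) -/(h (ordS i)).
by field.
Qed.

Lemma crossing_point i : cr i -> exists2 x, 0 < x < 1 &
  pt (T i) = ((1 - x) * (v i).1 + x * (v (ordS i)).1,
              (1 - x) * (v i).2 + x * (v (ordS i)).2).
Proof.
move=> ci; have d0 := cr_neq ci; exists ((p - h i) / (h (ordS i) - h i)).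
  move: ci; rewrite /cr /crosses /side /= -/(h i) -/(h (ordS i)).
  set x := _ / _; have pE : p = h i + x * (h (ordS i) - h i) by rewrite /x; field.
  rewrite pE [X in X < 0](_ : _ = (h (ordS i) - h i) ^+ 2 * (- (x * (1 - x)))); last by ring.
  rewrite pmulr_rlt0 ?exprn_even_gt0// oppr_lt0.
  by have [x0|x0] := ltP 0 x; [rewrite pmulr_rgt0//; lra|move=> ?; nra].
set Q := (_, _); rewrite -(line_pt_ht_tc th Q) /pt; congr (line_pt (_, th) _).
  rewrite (_ : ht th Q = h i + (p - h i) / (h (ordS i) - h i) * (h (ordS i) - h i)).
    by field.
  by rewrite /Q /h {1}/ht /=; rewrite /ht; ring.
by rewrite /Q /T /cross_t /side /= -/(h i) -/(h (ordS i)) /tc /=; ring.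
Qed.

Lemma region_crossing i : cr i -> region v (pt (T i)).
Proof.
move=> /crossing_point[x xI ->]; apply: region_segment; try exact: region_vertex.
by lra.
Qed.

Lemma crossing_neq i j : cr i -> cr j -> i != j -> T i != T j.
Proof.
move=> ci cj ij; apply/eqP => Tij; apply: (ncol ij).
have [x xI Xj] := crossing_point cj.
have := side_of_line_pt (T j) ci; rewrite Tij subrr mulr0 Xj => H.
have E : (1 - x) * (sg i * side_of v i (v j)) +
         x * (sg i * side_of v i (v (ordS j))) = 0.
  rewrite -[RHS](mulr0 (sg i)) -H !side_ofE /=; ring.
have h1 := sg_vertex i j; have h2 := sg_vertex i (ordS j).
have x1 : 0 < 1 - x by lra.
have x0 : 0 < x by lra.
have e1 := mulr_ge0 (ltW x1) h1; have e2 := mulr_ge0 (ltW x0) h2.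
have /eqP z1 : (1 - x) * (sg i * side_of v i (v j)) == 0 by apply/eqP; lra.
have /eqP z2 : x * (sg i * side_of v i (v (ordS j))) == 0 by apply/eqP; lra.
split => /=.
  by move/eqP: z1; rewrite !mulf_eq0 (negbTE (sg0 i)) gt_eqF//= => /eqP.
by move/eqP: z2; rewrite !mulf_eq0 (negbTE (sg0 i)) gt_eqF//= => /eqP.
Qed.

(** The supporting line of a side does not separate points of the half-planes. *)
Lemma half_planes_same_side i a b : cr i -> half_planes (pt a) -> half_planes (pt b) ->
  0 <= (T i - a) * (T i - b).
Proof.
move=> ci /(_ i) Ha /(_ i) Hb; have d0 := cr_neq ci.
rewrite !side_of_line_pt// in Ha Hb.
have k0 : 0 < (sg i * (h (ordS i) - h i)) ^+ 2 by rewrite exprn_even_gt0//= mulf_neq0.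
rewrite -(pmulr_rge0 _ k0).
rewrite [X in 0 <= X](_ : _ = (sg i * ((h (ordS i) - h i) * (T i - a))) *
  (sg i * ((h (ordS i) - h i) * (T i - b)))); last by ring.
exact: mulr_ge0.
Qed.

Lemma half_planes_between i j t : cr i -> cr j -> i != j -> half_planes (pt t) ->
  Num.min (T i) (T j) <= t <= Num.max (T i) (T j).
Proof.
move=> ci cj ij Ht.
have Hi := half_planes_same_side ci Ht (region_half_planes (region_crossing cj)).
have Hj := half_planes_same_side cj Ht (region_half_planes (region_crossing ci)).
have := crossing_neq ci cj ij; rewrite neq_lt => /orP[lt|lt].
  by rewrite (min_l (ltW lt)) (max_r (ltW lt)); apply/andP; split; nra.
by rewrite (min_r (ltW lt)) (max_l (ltW lt)); apply/andP; split; nra.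
Qed.

Lemma region_between i j t : cr i -> cr j -> i != j ->
  Num.min (T i) (T j) <= t <= Num.max (T i) (T j) -> region v (pt t).
Proof.
move=> ci cj ij tI; have Tij := crossing_neq ci cj ij.
have d0 : T j - T i != 0 by rewrite subr_eq0 eq_sym.
pose x := (t - T i) / (T j - T i).
have tE : t = (1 - x) * T i + x * T j by rewrite /x; field.
have -> : pt t = ((1 - x) * (pt (T i)).1 + x * (pt (T j)).1,
                  (1 - x) * (pt (T i)).2 + x * (pt (T j)).2).
  by rewrite {1}tE /pt /line_pt /=; congr (_, _); ring.
apply: region_segment; [exact: region_crossing..|].
move: Tij tI; rewrite neq_lt => /orP[lt|lt].
  rewrite (min_l (ltW lt)) (max_r (ltW lt)) => tI.
  by rewrite /x divr_ge0 ?ler_pdivrMr /=; lra.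
rewrite (min_r (ltW lt)) (max_l (ltW lt)) => tI.
have -> : x = (T i - t) / (T i - T j).
  by rewrite /x; field; rewrite d0 -opprB oppr_eq0 d0.
by rewrite divr_ge0 ?ler_pdivrMr /=; lra.
Qed.

(** Otherwise one of the three crossing points would be strictly between the two
    others, which are in the region, although its side supports the region. *)
Lemma crossing_third i j k : cr i -> cr j -> cr k -> i != j -> i != k -> j = k.
Proof.
move=> ci cj ck ij ik; apply/eqP; apply/negPn/negP => jk.
have Tij := crossing_neq ci cj ij; have Tik := crossing_neq ci ck ik.
have Tjk := crossing_neq cj ck jk.
have H i' (ci' : cr i') := region_half_planes (region_crossing ci').
have H1 := half_planes_same_side ci (H j cj) (H k ck).
have H2 := half_planes_same_side cj (H i ci) (H k ck).
have H3 := half_planes_same_side ck (H i ci) (H j cj).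
by move: Tij Tik Tjk; rewrite !neq_lt => /orP[]? /orP[]? /orP[]?; nra.
Qed.

Lemma crossing_exists k m : (forall i, h i != p) -> h k < p -> p < h m ->
  exists i, exists j, [/\ i != j, cr i & cr j].
Proof.
move=> hp hk hm.
have [i /andP[i1 i2]] : exists i, (h i < p) && (p < h (ordS i)).
  apply: contrapT => H; suff : h m < p by rewrite ltNge (ltW hm).
  apply: (@ordS_closed (fun i => h i < p) _ k m hk) => a ha.
  rewrite lt_neqAle hp leNgt; apply/negP => hSa; apply: H; exists a.
  by rewrite ha.
have [j /andP[j1 j2]] : exists j, (p < h j) && (h (ordS j) < p).
  apply: contrapT => H; suff : p < h k by rewrite ltNge (ltW hk).
  apply: (@ordS_closed (fun i => p < h i) _ m k hm) => a ha.
  rewrite lt_neqAle eq_sym hp leNgt; apply/negP => hSa; apply: H; exists a.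
  by rewrite ha.
exists i, j; split.
- by apply: contraTneq i1 => ->; rewrite -leNgt ltW.
- by rewrite /cr /crosses /= nmulr_rlt0 ?subr_gt0// subr_lt0.
- by rewrite /cr /crosses /= pmulr_rlt0 ?subr_gt0// subr_lt0.
Qed.

End FixedLine.

Lemma half_planes_crossing th P : half_planes P ->
  (forall k, ht th (v k) != ht th P) ->
  exists i, exists j, [/\ i != j, crosses th (ht th P) (side v i) &
                          crosses th (ht th P) (side v j)].
Proof.
move=> HP hp.
have htE Q : ht th Q = - sin th * Q.1 + cos th * Q.2 by rewrite /ht; ring.
have [m hm] := half_planes_linear_le (- sin th) (cos th) HP.
have [k hk] := half_planes_linear_le (sin th) (- cos th) HP.
apply: (@crossing_exists th (ht th P) k m) => //.
  by rewrite lt_neqAle hp /= !htE; lra.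
by rewrite lt_neqAle eq_sym hp /= !htE.
Qed.

Lemma finite_parallel_directions (w : plane R) : w != (0, 0) ->
  finite_set [set th : R | 0 <= th < pi /\ ht th w = 0].
Proof.
move=> w0; set N := [set th | _].
have [[a [aI ha]]|noN] := pselect (exists a, N a); last first.
  by rewrite (_ : N = set0)//; apply/seteqP; split => // th Nth; apply: noN; exists th.
suff H : N `<=` [set a] by exact: sub_finite_set H (finite_set1 a).
move=> th [thI hth] /=.
have E : tc th w * sin (th - a) = 0.
  rewrite -ha -[RHS]subr0 -[0 in RHS](mulr0 (cos (th - a))) -hth sinB cosB.
  transitivity ((cos th ^+ 2 + sin th ^+ 2) * (w.2 * cos a - w.1 * sin a)
    - (cos th * cos a + sin th * sin a) * ht th w); last first.
    by rewrite cos2Dsin2 mul1r.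
  by rewrite /tc /ht; ring.
have tc0 : tc th w != 0.
  apply: contraNneq w0 => tc0; rewrite -(line_pt_ht_tc th w) hth tc0 /line_pt /=.
  by rewrite !mul0r !subr0 addr0.
move/eqP: E; rewrite mulf_eq0 (negbTE tc0) /= => /eqP s0.
have [lt|lt|//] := ltgtP th a.
  have : 0 < sin (a - th) by apply: sin_gt0_pi; lra.
  by rewrite -opprB sinN s0 oppr0 ltxx.
have : 0 < sin (th - a) by apply: sin_gt0_pi; lra.
by rewrite s0 ltxx.
Qed.

Lemma generic_direction P : (forall k, P != v k) ->
  exists2 th, 0 <= th < pi & forall k, ht th (v k) != ht th P.
Proof.
move=> Pv; pose N k := [set th : R | 0 <= th < pi /\ ht th (vec (v k) P) = 0].
have fN : finite_set (\bigcup_(k in [set: 'I_n]) N k).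
  apply: bigcup_finite; first exact: finite_finset.
  move=> k _; apply: finite_parallel_directions.
  apply: contra (Pv k) => /eqP[] /eqP; rewrite subr_eq0 => /eqP P1 /eqP.
  by rewrite subr_eq0 => /eqP P2; apply/eqP; rewrite [P]surjective_pairing P1 P2 -surjective_pairing.
apply: contrapT => H.
have sub : `[0, pi[ `<=` \bigcup_(k in [set: 'I_n]) N k.
  move=> th; rewrite /= in_itv/= => thI.
  apply: contrapT => Nth; apply: H; exists th => // k.
  apply/eqP => hk; apply: Nth; exists k => //; split => //.
  by rewrite ht_vec hk subrr.
have := finite_lebesgue_measure0 (sub_finite_set sub fN).
rewrite lebesgue_measure_itv/= lte_fin pi_gt0 => -[/eqP].
by rewrite subr0 gt_eqF// pi_gt0.
Qed.

(** Through a point of all half-planes that is not a vertex there is a line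
    avoiding the vertices; it crosses two sides, between which the point lies. *)
Lemma region_half_planesE P : region v P <-> half_planes P.
Proof.
split; first exact: region_half_planes.
move=> HP; have [[k ->]|Pv] := pselect (exists k, P = v k); first exact: region_vertex.
have [th thI hP] : exists2 th, 0 <= th < pi & forall k, ht th (v k) != ht th P.
  by apply: generic_direction => k; apply/eqP => Pk; apply: Pv; exists k.
have [i [j [ij ci cj]]] := half_planes_crossing HP hP.
rewrite -(line_pt_ht_tc th P); apply: (region_between ci cj ij).
by apply: half_planes_between => //; rewrite line_pt_ht_tc.
Qed.

Lemma chord_length_crossing th p i j : crosses th p (side v i) ->
  crosses th p (side v j) -> i != j ->
  chord_length (region v) (p, th) =
  `|cross_t th p (side v i) - cross_t th p (side v j)|%:E.
Proof.
move=> ci cj ij; set x := cross_t _ _ _; set y := cross_t _ _ _.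
rewrite /chord_length.
have -> : line_pt (p, th) @^-1` chord (region v) (p, th) =
    `[Num.min x y, Num.max x y]%classic.
  apply/seteqP; split => t /=; rewrite in_itv/=.
    by move=> [/region_half_planes Kt _]; exact: half_planes_between.
  by move=> tI; split; [exact: (region_between ci cj ij)|exists t].
have xy : x != y := crossing_neq ci cj ij.
rewrite lebesgue_measure_itv/= lte_fin.
move: xy; rewrite neq_lt => /orP[xy|xy].
  by rewrite (min_l (ltW xy)) (max_r (ltW xy)) xy -EFinB distrC gtr0_norm// subr_gt0.
by rewrite (min_r (ltW xy)) (max_l (ltW xy)) xy -EFinB gtr0_norm// subr_gt0.
Qed.

Lemma chords_cut_lines th p (E : set R) : 0 <= th < pi ->
  (forall k, ht th (v k) != p) ->
  chords_with_length_in (region v) E (p, th) <->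
  exists ij : 'I_n * 'I_n, (ij.1 < ij.2)%N /\
    cut_lines th (side v ij.1) (side v ij.2) E p.
Proof.
move=> thI hp; split.
  move=> [_ [P [KP [t _ tP]]] [x Ex lx]].
  have hP : ht th P = p by rewrite -tP ht_line_pt.
  have [i [j [ij ci cj]]] : exists i, exists j,
      [/\ i != j, crosses th p (side v i) & crosses th p (side v j)].
    by rewrite -hP; apply: half_planes_crossing;
      [exact: region_half_planes|rewrite hP].
  have := chord_length_crossing ci cj ij; rewrite -lx => -[xE].
  have [lt|lt|/val_inj eq] := ltngtP i j; last by rewrite eq eqxx in ij.
    by exists (i, j); split => //=; split => //; rewrite -xE.
  by exists (j, i); split => //=; split => //; rewrite distrC -xE.
move=> [[i j] /= [lt [ci cj Eij]]].
have ij : i != j by apply: contraTneq lt => ->; rewrite ltnn.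
split => //.
  exists (line_pt (p, th) (cross_t th p (side v i))); split; first exact: region_crossing.
  by exists (cross_t th p (side v i)).
by rewrite (chord_length_crossing ci cj ij); eexists; [exact: Eij|].
Qed.

(** [crossing_third] for pairs: at most two sides are crossed by a line. *)
Lemma cut_lines_disjoint th p (E : set R) (ij kl : 'I_n * 'I_n) :
  (ij.1 < ij.2)%N -> (kl.1 < kl.2)%N ->
  cut_lines th (side v ij.1) (side v ij.2) E p ->
  cut_lines th (side v kl.1) (side v kl.2) E p -> ij = kl.
Proof.
case: ij => i j; case: kl => k l /= ltij ltkl [ci cj _] [ck cl _].
have ij : i != j by apply: contraTneq ltij => ->; rewrite ltnn.
have kl : k != l by apply: contraTneq ltkl => ->; rewrite ltnn.
have [ik|ik] := eqVneq i k.
  by subst k; rewrite (crossing_third ci cj cl ij kl).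
have jk := crossing_third ci cj ck ij ik; subst k.
have ji : j != i by rewrite eq_sym.
have := crossing_third cj cl ci kl ji => li; subst l.
by have := ltn_trans ltij ltkl; rewrite ltnn.
Qed.

End ConvexPolygon.

(** * The density of the length of the chords of a convex polygon *)

Section Assembly.
Variables (R : realType) (n : nat) (v : 'I_n -> plane R).
Notation mu := (@lebesgue_measure R).
Hypotheses (n2 : (2 < n)%N) (vI : injective v) (ncol : no_collinear_sides v).
Variable sg : 'I_n -> R.
Hypothesis sg0 : forall i, sg i != 0.
Hypothesis sg_vertex : forall i k, 0 <= sg i * side_of v i (v k).

Lemma pair_density_sides i j : i != j ->
  pair_density (side v i) (side v j) (rho_pair (side v i) (side v j)).
Proof.
move=> ij.
have side_neq k : (side v k).1 != (side v k).2.
  by apply/eqP => /vI /eqP; rewrite eq_sym (negbTE (ordS_neq k (ltnW n2))).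
have sep k l : weakly_separates (side v k) (side v l).
  have sk2 : 0 < sg k ^+ 2 by rewrite exprn_even_gt0//= sg0.
  rewrite /weakly_separates -(pmulr_rge0 _ sk2).
  rewrite [X in 0 <= X](_ : _ = (sg k * side_of v k (v l)) *
    (sg k * side_of v k (v (ordS l)))); first by rewrite mulr_ge0.
  by rewrite /side_of /side /=; ring.
have [N0|N0] := eqVneq (sides_N (side v i) (side v j)) 0.
  apply: pair_density_parallel => //.
  apply/eqP => H; apply: (ncol ij); split => //.
  rewrite -[LHS]subr0 -[X in _ - X]H -[RHS]N0.
  by rewrite /side_of /sides_N /det2 /vec /side /=; ring.
exact: pair_density_nonparallel.
Qed.

Let Pairs : seq ('I_n * 'I_n) := [seq ij : 'I_n * 'I_n <- index_enum ('I_n * 'I_n)%type | (ij.1 < ij.2)%N].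

Let mem_pairs ij : (ij \in Pairs) = (ij.1 < ij.2)%N.
Proof. by rewrite mem_filter mem_index_enum andbT. Qed.

Let big_pairs (V : nmodType) (F : 'I_n -> 'I_n -> V) :
  \sum_(i < n) \sum_(j < n | (i < j)%N) F i j = \sum_(ij <- Pairs) F ij.1 ij.2.
Proof. by rewrite pair_big_dep /= big_filter. Qed.

Lemma measurable_chord_length :
  measurable_fun [set: (measurableTypeR R * measurableTypeR R)%type]
    (chord_length (region v)).
Proof.
pose Z : set ((R * R) * R) := [set z | region v (line_pt z.1 z.2)].
have mZ : measurable Z.
  have -> : Z = \bigcap_(i in [set: 'I_n])
      [set z | 0 <= sg i * side_of v i (line_pt z.1 z.2)].
    apply/seteqP; split => z.
      by move=> /(region_half_planesE n2 ncol sg0 sg_vertex) Kz i _; exact: Kz.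
    move=> H; apply/(region_half_planesE n2 ncol sg0 sg_vertex) => i; exact: H.
  apply: fin_bigcap_measurable; first exact: finite_finset.
  move=> i _; rewrite -[X in measurable X]setTI; apply: measurable_fun_le => //.
  have mp : measurable_fun [set: (R * R) * R] (fun z => z.1.1).
    exact: (measurableT_comp measurable_fst measurable_fst).
  have mth : measurable_fun [set: (R * R) * R] (fun z => z.1.2).
    exact: (measurableT_comp measurable_snd measurable_fst).
  have mt : measurable_fun [set: (R * R) * R] (fun z => z.2) by exact: measurable_snd.
  have mc := measurableT_comp (@measurable_cos R) mth.
  have ms := measurableT_comp (@measurable_sin R) mth.
  have m1 : measurable_fun [set: (R * R) * R] (fun z => (line_pt z.1 z.2).1).
    by apply: measurable_funB; apply: measurable_funM.
  have m2 : measurable_fun [set: (R * R) * R] (fun z => (line_pt z.1 z.2).2).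
    by apply: measurable_funD; apply: measurable_funM.
  apply: measurable_funM => //; apply: measurable_funB.
    by apply: measurable_funM => //; exact: measurable_funB.
  by apply: measurable_funM => //; exact: measurable_funB.
have := measurable_fun_xsection mu mZ.
rewrite (_ : mu \o xsection Z = chord_length (region v))//.
apply/funext => q; rewrite /chord_length /=; congr (mu _).
apply/seteqP; split => t; rewrite /xsection /= ?inE.
  by move=> Kt; split => //; exists t.
by case.
Qed.

Lemma measurable_chords_with_length_in (E : set R) : measurable E -> E `<=` `]0, +oo[ ->
  @measurable _ (measurableTypeR R * measurableTypeR R)%type
    (chords_with_length_in (region v) E).
Proof.
move=> mE E0.
have -> : chords_with_length_in (region v) E =
    [set: R] `*` `[0, pi[ `&` (setT `&` chord_length (region v) @^-1` (EFin @` E)).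
  apply/seteqP; split => q; first by move=> [? _ ?].
  move=> [[_ lq] [_ Eq]]; split => //; apply/set0P/negP => /eqP c0.
  move: Eq; rewrite /= /chord_length c0 preimage_set0 measure0 => -[x /E0].
  by rewrite /= in_itv/= => x0 [xE]; rewrite xE ltxx in x0.
apply: measurableI; first by apply: measurableX => //; exact: measurable_itv.
apply: measurable_chord_length => //; exact: measurable_image_EFin.
Qed.

(** Vertices are avoided by almost all lines of a given direction. *)
Lemma measure_ysection_chords (th : R) (E : set R) : measurable E -> E `<=` `]0, +oo[ ->
  0 <= th < pi ->
  (forall ij : 'I_n * 'I_n, (ij.1 < ij.2)%N -> measurable (cut_lines th (side v ij.1) (side v ij.2) E)) ->
  mu (ysection (chords_with_length_in (region v) E) th) =
  (\sum_(ij <- Pairs) mu (cut_lines th (side v ij.1) (side v ij.2) E))%E.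
Proof.
move=> mE E0 thI mcut; pose N := range (fun k => ht th (v k)).
have fN : finite_set N by apply: finite_image; exact: finite_finset.
have mN := finite_measurableR fN.
pose F ij := cut_lines th (side v ij.1) (side v ij.2) E.
have mF ij : ij \in Pairs -> measurable (F ij) by rewrite mem_pairs; exact: mcut.
have mFN ij : ij \in Pairs -> measurable (F ij `\` N).
  by move=> /mF ?; exact: measurableD.
have fD : finite_set [set` Pairs] by exact: finite_seq.
have tF : trivIset [set` Pairs] (fun ij => F ij `\` N).
  move=> ij kl; rewrite /= !mem_pairs => ij_ kl_ [p [[Fij _] [Fkl _]]].
  exact: (cut_lines_disjoint ncol sg0 sg_vertex ij_ kl_ Fij Fkl).
transitivity (mu (\bigcup_(ij in [set` Pairs]) (F ij `\` N))).
  apply: (@lebesgue_measure_eq_off_finite _ _ _ N) => //.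
  - by apply: measurable_ysection; exact: measurable_chords_with_length_in.
  - by apply: fin_bigcup_measurable.
  - apply/seteqP; split => p [].
      rewrite /ysection /= inE => cp Np; split => //.
      have hp k : ht th (v k) != p by apply/eqP => hk; apply: Np; exists k.
      have [ij [ltij Fij]] := (chords_cut_lines n2 ncol sg0 sg_vertex E thI hp).1 cp.
      by exists ij; rewrite /= ?mem_pairs.
    move=> [ij /=]; rewrite mem_pairs => ltij [Fij Np] _; split => //.
    rewrite /ysection /= inE.
    have hp k : ht th (v k) != p by apply/eqP => hk; apply: Np; exists k.
    by apply: (chords_cut_lines n2 ncol sg0 sg_vertex E thI hp).2; exists ij.
rewrite measure_fin_bigcup// -fsbig_seq/=; last first.
  by apply: filter_uniq; exact: index_enum_uniq.
rewrite big_seq [RHS]big_seq; apply: eq_bigr => ij ijP.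
by apply: lebesgue_measureD_finite => //; exact: mF.
Qed.

Lemma is_chord_length_density_polygon :
  is_chord_length_density (region v)
    (fun l : R =>
       \sum_(i < n) \sum_(j < n | (i < j)%N) rho_pair (side v i) (side v j) l).
Proof.
have pd (ij : 'I_n * 'I_n) : exists gN : (R -> R) * set R, (ij.1 < ij.2)%N ->
  [/\ measurable_fun [set: R] gN.1, forall l, 0 <= gN.1 l, finite_set gN.2,
      forall l, 0 < l -> ~ gN.2 l -> rho_pair (side v ij.1) (side v ij.2) l = gN.1 l &
      forall E : set R, measurable E -> E `<=` `]0, +oo[ ->
      [/\ forall th, measurable (cut_lines th (side v ij.1) (side v ij.2) E),
          measurable_fun [set: R] (fun th => mu (cut_lines th (side v ij.1) (side v ij.2) E)) &
          (\int[mu]_(th in `[0%R, pi[) mu (cut_lines th (side v ij.1) (side v ij.2) E) =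
           \int[mu]_(l in E) (gN.1 l)%:E)%E]].
  have [lt|nlt] := boolP (ij.1 < ij.2)%N; last by exists (fun=> 0, set0).
  have ij_neq : ij.1 != ij.2 by apply: contraTneq lt => ->; rewrite ltnn.
  by have [g [N H]] := pair_density_sides ij_neq; exists (g, N).
have /choice[gN pdN] := pd.
pose g ij := (gN ij).1; pose N := \bigcup_(ij in [set` Pairs]) (gN ij).2.
have fN : finite_set N.
  apply: bigcup_finite; first exact: finite_seq.
  by move=> ij; rewrite /= mem_pairs => /pdN[].
have mI : measurable (`]0, +oo[%classic : set R) by exact: measurable_itv.
have mg : measurable_fun [set: R] (fun l => \sum_(ij <- Pairs) g ij l).
  apply: (eq_measurable_fun (fun l => \sum_(ij <- Pairs) (if (ij.1 < ij.2)%N then g ij l else 0))).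
    move=> l _; rewrite big_seq [RHS]big_seq; apply: eq_bigr => ij.
    by rewrite mem_pairs => ->.
  apply: measurable_sum => ij; case: (boolP (ij.1 < ij.2)%N) => [/pdN[mgij _ _ _ _]|_];
    [exact: mgij|exact: measurable_cst].
have g0 l : 0 <= \sum_(ij <- Pairs) g ij l.
  rewrite big_seq; apply: sumr_ge0 => ij; rewrite mem_pairs => /pdN[_ gij0 _ _ _].
  exact: gij0.
have rg l : 0 < l -> ~ N l -> \sum_(ij <- Pairs) g ij l =
    \sum_(i < n) \sum_(j < n | (i < j)%N) rho_pair (side v i) (side v j) l.
  move=> l0 Nl; rewrite (big_pairs (fun i j => rho_pair (side v i) (side v j) l)).
  rewrite big_seq [RHS]big_seq; apply: eq_bigr => ij ijP.
  have := ijP; rewrite mem_pairs => /pdN[_ _ _ -> //].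
  by move=> Nij; apply: Nl; exists ij.
have mr : measurable_fun (`]0, +oo[%classic : set R) (fun l : R =>
    \sum_(i < n) \sum_(j < n | (i < j)%N) rho_pair (side v i) (side v j) l).
  apply: (measurable_eq_off_finite mI fN _ (measurable_funTS mg)).
  by move=> l; rewrite /= in_itv/= andbT; exact: rg.
split; first exact: mr.
move=> E mE E0; have mA := measurable_chords_with_length_in mE E0.
split; first exact: mA.
set A := chords_with_length_in _ _ in mA *.
have -> : line_measure A = (\int[mu]_th mu (ysection A th))%E.
  apply: (@product_measure_unique _ _ _ _ R mu mu (mu \x^ mu)%E) => // B C mB mC.
  exact: product_measure2E.
have mcut (ij : 'I_n * 'I_n) : (ij.1 < ij.2)%N -> forall th, measurable (cut_lines th (side v ij.1) (side v ij.2) E).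
  by move=> /pdN[_ _ _ _ /(_ E mE E0)[]].
transitivity (\int[mu]_(th in `[0%R, pi[)
    \sum_(ij <- Pairs) mu (cut_lines th (side v ij.1) (side v ij.2) E))%E.
  rewrite [RHS]integral_mkcond; apply: eq_integral => th _.
  rewrite patchE mem_setE in_itv/=; case: ifPn => thI.
    by apply: measure_ysection_chords => // ij /mcut.
  rewrite (_ : ysection A th = set0) ?measure0//.
  apply/seteqP; split => // p; rewrite /ysection /= inE => -[thI' _ _].
  by move/negP: thI; apply; move: thI'; rewrite /lines /= in_itv.
have mJ : measurable (`[0, pi[%classic : set R) by exact: measurable_itv.
pose cutm (ij : 'I_n * 'I_n) (th : R) := if (ij.1 < ij.2)%N then mu (cut_lines th (side v ij.1) (side v ij.2) E) else 0%E.
transitivity (\int[mu]_(th in `[0%R, pi[) \sum_(ij <- Pairs) cutm ij th)%E.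
  apply: eq_integral => th _; rewrite big_seq [RHS]big_seq; apply: eq_bigr => ij.
  by rewrite mem_pairs /cutm => ->.
rewrite ge0_integral_sum//; last 2 first.
- move=> ij; rewrite /cutm; case: (boolP (ij.1 < ij.2)%N) => [lt|_]; last exact: measurable_cst.
  by have [_ _ _ _ /(_ E mE E0)[_ mc _]] := pdN ij lt; exact: measurable_funTS.
- by move=> ij th _; rewrite /cutm; case: ifP.
transitivity (\sum_(ij <- Pairs) \int[mu]_(l in E) (g ij l)%:E)%E.
  rewrite big_seq [RHS]big_seq; apply: eq_bigr => ij; rewrite mem_pairs => lt.
  rewrite /cutm lt; by have [_ _ _ _ /(_ E mE E0)[_ _ ->]] := pdN ij lt.
transitivity (\int[mu]_(l in E) (\sum_(ij <- Pairs) g ij l)%:E)%E.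
  pose g' (ij : 'I_n * 'I_n) (l : R) := if (ij.1 < ij.2)%N then g ij l else 0.
  transitivity (\sum_(ij <- Pairs) \int[mu]_(l in E) (g' ij l)%:E)%E.
    rewrite big_seq [RHS]big_seq; apply: eq_bigr => ij; rewrite mem_pairs => lt.
    by rewrite /g' lt.
  rewrite -ge0_integral_sum//.
  - apply: eq_integral => l _; rewrite sumEFin; congr EFin.
    rewrite big_seq [RHS]big_seq; apply: eq_bigr => ij.
    by rewrite mem_pairs /g' => ->.
  - move=> ij; apply/measurable_EFinP; rewrite /g'.
    case: (boolP (ij.1 < ij.2)%N) => [/pdN[mgij _ _ _ _]|_];
      [exact: measurable_funTS|exact: measurable_cst].
  - move=> ij l _; rewrite lee_fin /g'; case: ifP => // /pdN[_ gij0 _ _ _].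
    exact: gij0.
apply: (@integral_eq_off_finite _ E N) => //.
- by apply/measurable_EFinP; exact: measurable_funTS.
- by apply/measurable_EFinP; exact: measurable_funS mr.
- move=> l /E0; rewrite /= in_itv/= andbT => l0 Nl; congr EFin; exact: rg.
Qed.

End Assembly.

Theorem proposition5p1 (R : realType) (n : nat) (v : 'I_n -> plane R) :
  convex_polygon v -> no_collinear_sides v ->
  is_chord_length_density (region v)
    (fun l : R =>
       \sum_(i < n) \sum_(j < n | (i < j)%N) rho_pair (side v i) (side v j) l).
Proof.
move=> [n2 vI sideP] ncol.
have /choice[sg sgP] : forall i, exists s : R, s != 0 /\ forall k, 0 <= s * side_of v i (v k).
  move=> i; case: (sideP i) => H; first by exists 1; split=> [|k]; rewrite ?oner_neq0 ?mul1r.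
  by exists (-1); split=> [|k]; rewrite ?oppr_eq0 ?oner_neq0// mulN1r oppr_ge0.
by apply: (@is_chord_length_density_polygon R n v n2 vI ncol sg) => i; have [] := sgP i.
Qed.
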